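(* Let $K$ be an algebraically closed field, $n\geq 2$, $\ell\geq 1$, $\underline{x}=(x_1,\ldots,x_n)$. Let $P=\gamma x_1^{e_1}\cdots x_n^{e_n}$ ($\gamma\in K$, $\gamma\neq 0$) be a non-constant monomial and let $Q_1,\ldots,Q_\ell$ be monomials with $\deg(Q_i)\leq\deg(P)$ such that $P,Q_1,\ldots,Q_\ell$ are pairwise distinct up to multiplicative constants and relatively prime. The following are equivalent: (1) The polynomial $P+\lambda_1Q_1+\cdots+\lambda_\ell Q_\ell$ is reducible in $\overline{K(\underline{\lambda})}[\underline{x}]$ (that is, $\{Q_1,\ldots,Q_\ell\}$ is a reducibility monomial site of $P$). (2) (a) Either $\mathrm{char}\,K=p>0$ and $P,Q_1,\ldots,Q_\ell\in K[\underline{x}^p]$, (b) or $P,Q_1,\ldots,Q_\ell$ are (up to non-zero multiplicative constants) of the form $m_1^km_2^{d-k}$ ($0\leq k\leq d$) for some relatively prime monomials $m_1$ and $m_2$ and some integer $d>1$, and they include $m_1^d$ and $m_2^d$. Furthermore, for all $(\phi,\psi)$-homogeneous decompositions of $P+\lambda_1Q_1+\cdots+\lambda_\ell Q_\ell$, $(\phi,\psi)$ is a couple of monomials, up to some element $L\in\mathrm{GL}_2(K)$.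
   Context: $\underline{\lambda}=(\lambda_1,\ldots,\lambda_\ell)$ are independent indeterminates, $\overline{k}$ denotes an algebraic closure of a field $k$, and $K[\underline{x}^p]=K[x_1^p,\ldots,x_n^p]$. ''$P,Q_1,\ldots,Q_\ell$ relatively prime'' means that no non-constant polynomial divides all of them. Monomials may have all exponents $0$. Put $F=P+\lambda_1Q_1+\cdots+\lambda_\ell Q_\ell$. Given relatively prime $\phi,\psi\in K[\underline{x}]$ with $\deg_{\underline{x}}(F)>\max(\deg(\phi),\deg(\psi))$, a $(\phi,\psi)$-homogeneous decomposition of $F$ is an identity $F(\underline{x},\underline{\lambda})=H(\phi(\underline{x}),\psi(\underline{x}),\underline{\lambda})$ with $H(u,v,\underline{\lambda})\in\overline{K(\underline{\lambda})}[u,v]$ homogeneous in $(u,v)$. *)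

(* Defs.v *)
From HB Require Import structures.
From mathcomp Require Import all_boot all_order all_algebra.
From mathcomp Require Export mpoly.

Set Implicit Arguments.
Unset Strict Implicit.
Unset Printing Implicit Defensive.

Import GRing.Theory.
Local Open Scope ring_scope.

(* Degrees are expressed with [msize], which is 1 + the total degree for a
   nonzero polynomial and 0 for the zero polynomial; hence [1 < msize p] says
   that [p] is non-constant. *)

Section Polynomials.
Variables (K : fieldType) (n : nat).
Implicit Types (p q : {mpoly K[n]}) (s : seq {mpoly K[n]}).

Definition is_monomial p : Prop :=
  exists (c : K) (m : 'X_{1..n}), c != 0 /\ p = c *: 'X_[m].

Definition eq_upto_const p q : Prop :=
  exists2 c : K, c != 0 & p = c *: q.

Definition mpoly_dvd p q : Prop := exists r, q = r * p.

Definition relatively_prime s : Prop :=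
  forall p, (1 < msize p)%N -> ~ (forall q, q \in s -> mpoly_dvd p q).

Definition reducible p : Prop :=
  exists q r, [/\ (1 < msize q)%N, (1 < msize r)%N & p = q * r].

(* Membership in K[x_1^a, ..., x_n^a]. *)
Definition in_powers (a : nat) p : Prop :=
  exists q, p = q \mPo [tuple 'X_i ^+ a | i < n].

End Polynomials.

(* There is no algebraic closure of an arbitrary field in the library, so an
   algebraic closure of k is represented by any closed field C together with a
   morphism iota : k -> C over whose image C is algebraic. *)
Definition is_algebraic_closure (k : fieldType) (C : closedFieldType)
    (iota : {rmorphism k -> C}) : Prop :=
  forall u : C, algebraicOver iota u.

Section Generic.
Variables (K : fieldType) (n l : nat) (C : closedFieldType).
Variable iota : {rmorphism {fraction {mpoly K[l]}} -> C}.

Definition base_emb (c : K) : C := iota (tofrac c%:MP_[l]).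

Definition lam (i : 'I_l) : C := iota (tofrac 'X_i).

Definition ext_poly (p : {mpoly K[n]}) : {mpoly C[n]} := map_mpoly base_emb p.

Definition generic_sum (P : {mpoly K[n]}) (Q : 'I_l -> {mpoly K[n]}) :
    {mpoly C[n]} :=
  ext_poly P + \sum_(i < l) lam i *: ext_poly (Q i).

Definition homogeneous_decomposition (F : {mpoly C[n]})
    (phi psi : {mpoly K[n]}) (H : {mpoly C[2]}) : Prop :=
  [/\ relatively_prime [:: phi; psi],
      (maxn (msize phi) (msize psi) < msize F)%N,
      exists d : nat, H \is d.-homog
    & F = H \mPo [tuple ext_poly phi; ext_poly psi]].

End Generic.

Definition monomial_couple_upto_GL2 (K : fieldType) (n : nat)
    (phi psi : {mpoly K[n]}) : Prop :=
  exists (L : 'M[K]_2) (m1 m2 : {mpoly K[n]}),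
    [/\ L \in unitmx, is_monomial m1, is_monomial m2,
        phi = L 0 0 *: m1 + L 0 1 *: m2
      & psi = L 1 0 *: m1 + L 1 1 *: m2].

(* Main.v *)
Require Import Defs.
From HB Require Import structures.
From mathcomp Require Import all_boot all_order all_algebra all_field.
From mathcomp Require Import zify ring.
From Stdlib Require Import Classical ClassicalEpsilon.

(** Let [F] be the generic sum, [C] the algebraic closure of the field of
    rational functions in the [lambda]s, and [p] the characteristic.

    Sufficiency. If all terms are polynomials in the [p]-th powers of the
    variables, [F] is a [p]-th power as [C] is perfect. If they are terms of
    degree [d] in two monomials, [F] is a binary form of degree [d > 1] in them
    and splits over [C] ([form_split]).

    Necessity of the shape. Suppose [F] is reducible. Polynomials over a field
    have unique factorization ([factorial_mpoly]), so [F] is a power [f ^ e] or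
    a product [Phi * G] of coprime factors ([reducible_cases]). Differentiate
    with respect to each [lambda]. The coefficients of the factors might be
    inseparable over the rational functions in the [lambda]s, so that
    derivations need not extend to them; but some nonzero derivation always
    exists on the field they generate ([derivation_extension]), and coprimality
    turns this into an extension. When [F = f ^ e] and [e] is nonzero in [C],
    it follows that [f] divides the monomials [Q i], which is absurd as no
    variable divides [F]; when [e = 0] in [C], [F] is a [p]-th power, and all
    its terms are polynomials in the [p]-th powers of the variables. When
    [F = Phi * G], the outcome is that every monomial [x^s] of [F] can be written
    [u * G + Phi * v], where the monomials of [v] are monomials of [G].

    Let [xi] be a generic zero of [G]. There [xi^s = Phi(xi) v(xi)], and by the
    lemma of Dedekind and Mertens ([dedekind_mertens]) the quotient of any
    monomial [xi^b] of [Phi] by [Phi(xi)] maps a finite-dimensional [C]-space,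
    spanned by products of monomials, into itself. It is thus an eigenvalue of a
    matrix over [C], that is, a constant ([monomial_ratio_const]). So any two
    monomials of [Phi] have a constant ratio on [G = 0]. Since all but one of
    the coordinates of [xi] are algebraically independent, the exponents of
    [Phi] lie on a line. By symmetry those of [G] do, and the lines are parallel
    ([supports_on_line]). Thus the exponents of [F] lie on a line, and no
    variable dividing [F] they are, with [v] the primitive direction, of the form
    [k v+ + (d - k) v-], where [d] is the sum of the lengths of the two segments
    supporting [Phi] and [G], whence [d > 1] ([two_monomial_form]).

    Homogeneous decompositions. If [F = H(phi, psi)], then, as [1] and the
    [lambda]s are linearly independent over [K], each term of [F] is itself the
    value at [(phi, psi)] of a form over [K] ([generic_sum_span]). That form is a
    product of linear forms whose values divide a monomial, hence are monomials.
    Two of these linear forms are not proportional, since otherwise [P] and the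
    [Q i] would be ([decomposition_monomial_couple]). *)

Set Implicit Arguments.
Unset Strict Implicit.
Unset Printing Implicit Defensive.

Import GRing.Theory.
Local Open Scope ring_scope.

(** * Supports of products *)

Lemma msumm_cons n (b : 'X_{1..n}) bs :
  (\sum_(x <- b :: bs) x)%MM = (b + \sum_(x <- bs) x)%MM.
Proof. by rewrite big_cons. Qed.

(** The lemma of Dedekind and Mertens on the contents of [f], [g] and [f * g],
    for the monomials themselves in the role of the coefficients. An exponent
    [b + c], with [b] and [c] in the supports of [f] and [g], may cancel in
    [f * g]; the lemma recovers it when it comes with enough further exponents
    of [f]. Induction on the number of terms: removing the leading term of [g]
    costs one exponent of [f], and the sum of the two leading exponents never
    cancels. *)
Lemma dedekind_mertens (C : idomainType) n (f g : {mpoly C[n]}) (bs : seq 'X_{1..n}) (c : 'X_{1..n}) :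
    (size (msupp g) <= size bs)%N -> {subset bs <= msupp f} -> c \in msupp g ->
  exists (bs' : seq 'X_{1..n}) (s : 'X_{1..n}), [/\ (size bs').+1 = size bs, {subset bs' <= msupp f},
    s \in msupp (f * g) & (\sum_(b <- bs) b + c = \sum_(b <- bs') b + s)%MM].
Proof.
have [m] := ubnP (size (msupp f) + size (msupp g)).
elim: m f g bs c => // m IH f g bs c; rewrite ltnS => hm hs hb hc.
have [f0|f0] := eqVneq f 0.
  move: hs hb hc; rewrite f0 msupp0; case: bs => [|b bs] /=.
    by rewrite leqn0 size_eq0 => /eqP->.
  by move=> _ /(_ b); rewrite mem_head => /(_ isT).
have [g0|g0] := eqVneq g 0; first by rewrite g0 msupp0 in hc.
pose f' := f - f@_(mlead f) *: 'X_[mlead f].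
pose g' := g - g@_(mlead g) *: 'X_[mlead g].
have top : (mlead f + mlead g)%MM \in msupp (f * g).
  by rewrite -mleadM // mlead_supp // mulf_neq0.
have pf : perm_eq (msupp f') (rem (mlead f) (msupp f)) := msupp_rem _ _.
have pg : perm_eq (msupp g') (rem (mlead g) (msupp g)) := msupp_rem _ _.
have sf : (size (msupp f')).+1 = size (msupp f).
  by rewrite (perm_size pf) size_rem ?mlead_supp // prednK //; case: (msupp f) (mlead_supp f0).
have sg : (size (msupp g')).+1 = size (msupp g).
  by rewrite (perm_size pg) size_rem ?mlead_supp // prednK //; case: (msupp g) (mlead_supp g0).
have mf x : (x \in msupp f') = (x != mlead f) && (x \in msupp f).
  by rewrite (perm_mem pf) mem_rem_uniq ?msupp_uniq // inE.
have mg x : (x \in msupp g') = (x != mlead g) && (x \in msupp g).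
  by rewrite (perm_mem pg) mem_rem_uniq ?msupp_uniq // inE.
have main (bs1 : seq 'X_{1..n}) (c1 : 'X_{1..n}) : (size (msupp g) <= (size bs1).+1)%N ->
    {subset bs1 <= msupp f} -> c1 \in msupp g ->
  exists (bs' : seq 'X_{1..n}) (s : 'X_{1..n}), [/\ (size bs') = size bs1, {subset bs' <= msupp f},
    s \in msupp (f * g)
    & (mlead f + \sum_(b <- bs1) b + c1 = \sum_(b <- bs') b + s)%MM].
  move=> hs1 hb1 hc1; have [->|nc] := eqVneq c1 (mlead g).
    by exists bs1, (mlead f + mlead g)%MM; split=> //;
    apply/mnmP=> i; rewrite !mnmDE; clear; lia.
  have [||||bs' [s [e1 e2 e3 e4]]] := IH f g' bs1 c1.
  - by apply: leq_trans hm; rewrite -sg addnS.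
  - by rewrite -ltnS sg.
  - by [].
  - by rewrite mg nc.
  have sub' : {subset mlead f :: bs' <= msupp f}.
    by move=> x; rewrite inE => /predU1P[->|/e2//]; apply: mlead_supp.
  have [sfg|sfg] := boolP (s \in msupp (f * g)).
    by exists (mlead f :: bs'), s; split; rewrite // msumm_cons -!addmA e4.
  have : s \in msupp (f * (g@_(mlead g) *: 'X_[mlead g])).
    have := e3; rewrite /g' mulrBr => /msuppB_le; rewrite mem_cat (negPf sfg).
    by [].
  rewrite -scalerAr => /msuppZ_le; rewrite (perm_mem (msuppMX _ _)).
  case/mapP=> b bf es.
  exists (b :: bs'), (mlead f + mlead g)%MM; split; rewrite //=.
    by move=> x; rewrite inE => /predU1P[->//|/e2//].
  rewrite msumm_cons; apply/mnmP=> i; move/mnmP/(_ i): e4.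
  rewrite es !mnmDE; clear; lia.
have [lb|lb] := boolP (mlead f \in bs).
  have pb : perm_eq bs (mlead f :: rem (mlead f) bs) by apply: perm_to_rem.
  have [|||bs' [s [e1 e2 e3 e4]]] := main (rem (mlead f) bs) c.
  - by rewrite -[(_).+1]/(size (mlead f :: rem (mlead f) bs)) -(perm_size pb).
  - by move=> x /mem_rem; apply: hb.
  - by [].
  exists bs', s; split=> //; first by rewrite e1 -[(_).+1]/(size (mlead f :: rem (mlead f) bs)) -(perm_size pb).
  by rewrite -e4 (perm_big _ pb) msumm_cons.
have [||||bs' [s [e1 e2 e3 e4]]] := IH f' g bs c.
- by apply: leq_trans hm; rewrite -sf addSn.
- by [].
- by move=> x xb; rewrite mf hb // andbT; apply: contraNneq lb => <-.
- by [].
have sub' : {subset bs' <= msupp f} by move=> x /e2; rewrite mf => /andP[].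
have [sfg|sfg] := boolP (s \in msupp (f * g)); first by exists bs', s.
have : s \in msupp ((f@_(mlead f) *: 'X_[mlead f]) * g).
  have := e3; rewrite /f' mulrBl => /msuppB_le; rewrite mem_cat (negPf sfg).
  by [].
rewrite -scalerAl mulrC => /msuppZ_le; rewrite (perm_mem (msuppMX _ _)).
case/mapP=> d dg es; have [|bs2 [s2 [h1 h2 h3 h4]]] := main bs' d _ sub' dg.
  by rewrite e1.
exists bs2, s2; split=> //; first by rewrite h1.
apply/mnmP=> i; move/mnmP/(_ i): e4; move/mnmP/(_ i): h4.
by rewrite es !mnmDE; clear; lia.
Qed.

(** * Generic zeros *)

Lemma irreducible_factor (F : fieldType) (p : {poly F}) :
  (1 < size p)%N -> exists q, irreducible_poly q /\ q %| p.
Proof.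
have [m] := ubnP (size p); elim: m p => // m IH p hm sp.
have [irr|] := classic (irreducible_poly p); first by exists p.
move=> nirr; have [q [sq qp npq]] :
    exists q : {poly F}, [/\ size q != 1%N, q %| p & ~~ (q %= p)].
  have [//|no] := classic (exists q : {poly F}, [/\ size q != 1%N, q %| p & ~~ (q %= p)]).
  case: nirr; split=> // q sq qp; have [//|nqp] := boolP (q %= p).
  by case: no; exists q.
have p0 : p != 0 by rewrite -size_poly_gt0 ltnW.
have q0 : q != 0 by apply: contraTneq qp => ->; rewrite dvd0p.
have lt_qp : (size q < size p)%N.
  by rewrite ltn_neqAle dvdp_leq // andbT -(dvdp_size_eqp qp) in npq *.
have [||r [irr rq]] := IH q; first exact: leq_trans lt_qp _.
  by have := q0; rewrite -size_poly_gt0; case: (size q) sq => [|[]].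
by exists r; split=> //; apply: dvdp_trans qp.
Qed.

Section MonomialValues.
Variables (L : fieldType) (n : nat) (xi : 'I_n -> L).
Implicit Types m : 'X_{1..n}.

Lemma mmap1D m1 m2 : mmap1 xi (m1 + m2)%MM = mmap1 xi m1 * mmap1 xi m2.
Proof.
by rewrite /mmap1 -big_split; apply: eq_bigr => i _; rewrite mnmDE exprD.
Qed.

Lemma mmap1Mn m k : mmap1 xi (m *+ k)%MM = mmap1 xi m ^+ k.
Proof.
rewrite /mmap1 -prodrXl; apply: eq_bigr => i _.
by rewrite mulmnE exprM.
Qed.

Lemma mmap1_neq0 m : (forall i, xi i != 0) -> mmap1 xi m != 0.
Proof. by move=> h; apply/prodf_neq0 => i _; rewrite expf_neq0. Qed.

End MonomialValues.

Lemma horner_map_monomial (F L : fieldType) (al : {rmorphism F -> L}) a k z :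
  (map_poly al (a%:P * 'X^k)).[z] = al a * z ^+ k.
Proof. by rewrite rmorphM /= map_polyC map_polyXn hornerM hornerC hornerXn. Qed.

(** Solve [G = 0] for a variable [i0] that occurs in [G], in an extension of
    the rational functions in the variables. The solution is not zero since
    this variable does not divide [G], and the other coordinates are
    independent variables. *)
Lemma generic_zero (C : fieldType) n (G : {mpoly C[n]}) (m0 : 'X_{1..n}) :
    m0 \in msupp G -> m0 != 0%MM ->
    (forall i, exists2 m : 'X_{1..n}, m \in msupp G & m i = 0%N) ->
  exists (L : fieldType) (emb : {rmorphism C -> L}) (xi : 'I_n -> L) (i0 : 'I_n),
    [/\ mmap emb xi G = 0, forall i, xi i != 0
      & forall (m1 m2 : 'X_{1..n}) c, m1 i0 = m2 i0 ->
          mmap1 xi m1 = emb c * mmap1 xi m2 -> m1 = m2].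
Proof.
move=> m0G m00 hG.
have [i0 hi0] : exists i, m0 i != 0%N.
  have [//|no] := classic (exists i, m0 i != 0%N).
  case/eqP: m00; apply/mnmP=> i; rewrite mnm0E; apply/eqP.
  by case: eqP => // /eqP h; case: no; exists i.
pose k2 : fieldType := {fraction {mpoly C[n]}}.
pose fr : {rmorphism {mpoly C[n]} -> k2} := @tofrac {mpoly C[n]}.
pose strip (m : 'X_{1..n}) := [multinom (if i == i0 then 0 else m i)%N | i < n].
pose c1 : {rmorphism C -> {poly k2}} := (polyC \o fr \o @mpolyC n C).
pose h i : {poly k2} := if i == i0 then 'X else (fr 'X_i)%:P.
have hE m : mmap1 h m = (fr 'X_[strip m])%:P * 'X^(m i0).
  rewrite /mmap1 (bigD1 i0) //= /h eqxx mulrC; congr (_ * _).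
  rewrite mpolyXE_id !rmorph_prod [RHS](bigD1 i0) //= mnmE eqxx expr0 !rmorph1 mul1r.
  by apply: eq_bigr => i ii; rewrite mnmE (negPf ii) !rmorphXn.
have uE k : (mmap c1 h G)`_k =
    fr (\sum_(m <- msupp G | m i0 == k) G@_m *: 'X_[strip m]).
  rewrite /mmap coef_sum raddf_sum [RHS]big_mkcond; apply: eq_bigr => m _.
  rewrite hE /c1 /= mulrA -polyCM coefCM coefXn eq_sym -rmorphM mul_mpolyC.
  by case: eqP; rewrite ?mulr1 ?mulr0.
have u0 (m : 'X_{1..n}) : m \in msupp G -> (mmap c1 h G)`_(m i0) != 0.
  move=> mG; rewrite uE tofrac_eq0.
  apply/negP=> /eqP /(congr1 (mcoeff (strip m))).
  rewrite raddf_sum /= mcoeff0 -big_filter.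
  rewrite (bigD1_seq m) ?filter_uniq ?msupp_uniq ?mem_filter ?eqxx //=.
  rewrite mcoeffZ mcoeffX eqxx mulr1 big_filter_cond big1 ?addr0 => [z|m' /andP[/eqP e ne]].
    by move: mG; rewrite mcoeff_msupp z eqxx.
  rewrite mcoeffZ mcoeffX; case: eqP => [es|]; rewrite ?mulr0 //.
  case/eqP: ne; apply/mnmP=> i; have [->//|ii] := eqVneq i i0.
  by have := congr1 (fun s : 'X_{1..n} => s i) es; rewrite /= !mnmE (negPf ii).
have [p [irr pG]] : exists p, irreducible_poly p /\ p %| mmap c1 h G.
  apply: irreducible_factor; apply: leq_trans (_ : (m0 i0).+1 <= _)%N; first by rewrite ltnS lt0n.
  by rewrite ltnNge; apply: contra (u0 _ m0G) => hs; rewrite nth_default.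
have [L [al [z pz]]] : exists (L : fieldType) (al : {rmorphism k2 -> L}) z,
    root (map_poly al p) z.
  by have [L _ [z pz _]] := irredp_FAdjoin irr; exists L, (in_alg L), z.
pose emb : {rmorphism C -> L} := (al \o fr \o @mpolyC n C).
pose xi i : L := if i == i0 then z else al (fr 'X_i).
have xiE m : mmap1 xi m = al (fr 'X_[strip m]) * z ^+ m i0.
  rewrite /mmap1 (bigD1 i0) //= /xi eqxx mulrC; congr (_ * _).
  rewrite mpolyXE_id !rmorph_prod [RHS](bigD1 i0) //= mnmE eqxx expr0 !rmorph1 mul1r.
  by apply: eq_bigr => i ii; rewrite mnmE (negPf ii) !rmorphXn.
have xiG : mmap emb xi G = (map_poly al (mmap c1 h G)).[z].
  rewrite /mmap rmorph_sum horner_sum; apply: eq_bigr => m _.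
  have -> : c1 G@_m * mmap1 h m = (fr (G@_m)%:MP * fr 'X_[strip m])%:P * 'X^(m i0).
    by rewrite hE polyCM mulrA.
  by rewrite horner_map_monomial xiE rmorphM mulrA.
have root_z : root (map_poly al (mmap c1 h G)) z.
  by apply: root_dvdp pz; rewrite dvdp_map.
have z0 : z != 0.
  apply/negP=> /eqP ze; have [m mG mi] := hG i0.
  have := u0 m mG; rewrite mi; move: root_z.
  by rewrite ze rootE horner_coef0 coef_map fmorph_eq0 => ->.
exists L, emb, xi, i0; split.
- by rewrite xiG; apply/rootP.
- move=> i; rewrite /xi; case: (i == i0) => //.
  by rewrite fmorph_eq0 tofrac_eq0 -msize_poly_eq0 msizeX.
- move=> m1 m2 c e12; rewrite !xiE e12 mulrA => /(mulIf (expf_neq0 _ z0)).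
  rewrite /emb /= -!rmorphM /= => /fmorph_inj /eqP; rewrite tofrac_eq mul_mpolyC.
  move/eqP=> es; apply/mnmP=> i; have [->//|ii] := eqVneq i i0.
  suff : strip m1 = strip m2.
    by move/(congr1 (fun s : 'X_{1..n} => s i)); rewrite /= !mnmE (negPf ii).
  move/(congr1 (mcoeff (strip m1))): es; rewrite mcoeffZ !mcoeffX eqxx.
  by case: eqP => // _ /eqP; rewrite mulr0 oner_eq0.
Qed.

(** * Monomials at a generic zero *)

(** [th] is an eigenvalue of a matrix over [C], whose characteristic polynomial
    splits over [C]. *)
Lemma scalar_eigenvalue (C : closedFieldType) (L : fieldType)
    (emb : {rmorphism C -> L}) N (w : 'I_N -> L) (j0 : 'I_N) (th : L) :
    w j0 != 0 ->
    (forall j, exists a : 'I_N -> C, th * w j = \sum_k emb (a k) * w k) ->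
  exists tau, th = emb tau.
Proof.
move=> wj0 /fin_all_exists [a ha].
pose A : 'M[C]_N := \matrix_(k, j) a j k.
have : eigenvalue (map_mx emb A) th.
  apply/eigenvalueP; exists (\row_j w j); last first.
    by apply/negP=> /eqP /rowP /(_ j0); rewrite !mxE => /eqP; rewrite (negPf wj0).
  apply/rowP=> j; rewrite !mxE ha; apply: eq_bigr => k _.
  by rewrite !mxE mulrC.
rewrite eigenvalue_root_char -map_char_poly.
have [r ->] := closed_field_poly_normal (char_poly A).
rewrite map_polyZ rootZ; last by rewrite fmorph_eq0 lead_coef_eq0 monic_neq0 ?char_poly_monic.
rewrite rmorph_prod rootE horner_prod prodf_seq_eq0 => /hasP[z _].
rewrite /= rmorphB /= map_polyX map_polyC hornerXsubC subr_eq0 => /eqP->.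
by exists z.
Qed.

Section SupportSums.
Variables (C : idomainType) (n : nat) (B Ga : seq 'X_{1..n}).

Fixpoint support_sums k : seq 'X_{1..n} :=
  if k is k'.+1 then [seq (b + e)%MM | b <- B, e <- support_sums k'] else Ga.

Lemma support_sumsP k e : reflect (exists bs c,
    [/\ size bs = k, {subset bs <= B}, c \in Ga & e = (\sum_(b <- bs) b + c)%MM])
  (e \in support_sums k).
Proof.
elim: k e => [|k IH] e /=; apply: (iffP idP).
- by move=> eG; exists [::], e; split=> //; rewrite big_nil add0m.
- by case=> bs [c [/size0nil-> _ cG ->]]; rewrite big_nil add0m.
- case/allpairsP=> [[b e'] /= [bB /IH[bs [c [s1 s2 s3 ->]]] ->]].
  exists (b :: bs), c; split=> //=; first by rewrite s1.
    by move=> x; rewrite inE => /predU1P[->|/s2].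
  by rewrite big_cons addmA.
- case=> [] [//|b bs] [c [//= [s1] s2 s3 ->]]; apply/allpairsP.
  exists (b, \sum_(x <- bs) x + c)%MM; rewrite /= big_cons addmA.
  split=> //; first by apply: s2; rewrite inE eqxx.
  by apply/IH; exists bs, c; split=> // x xb; apply: s2; rewrite inE xb orbT.
Qed.

End SupportSums.

(** If every monomial of [f * g] becomes, at the point [xi], a multiple of
    [f xi] by a combination of the monomials of [g], then the ratios of the
    monomials of [f] to [f xi] are eigenvalues, hence constants: by
    [dedekind_mertens] they stabilize the space spanned by the products of
    [k] monomials of [f] and one monomial of [g]. *)
Lemma monomial_ratio_const (C : closedFieldType) (L : fieldType)
    (emb : {rmorphism C -> L}) n (xi : 'I_n -> L) (f g : {mpoly C[n]})
    (b : 'X_{1..n}) :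
    (forall i, xi i != 0) -> g != 0 -> mmap emb xi f != 0 ->
    (forall s, s \in msupp (f * g) -> exists2 v : {mpoly C[n]},
       {subset msupp v <= msupp g} & mmap1 xi s = mmap emb xi f * mmap emb xi v) ->
  b \in msupp f -> exists tau, mmap1 xi b = emb tau * mmap emb xi f.
Proof.
move=> xi0 g0 f0 hs bf; pose k := (size (msupp g)).-1.
have kE : (size (msupp g) = k.+1)%N by rewrite prednK // lt0n size_eq0 msupp_eq0.
pose E := support_sums (msupp f) (msupp g) k.
pose w (j : 'I_(size E)) := mmap1 xi (nth 0%MM E j).
pose span y := exists a : 'I_(size E) -> C, y = \sum_j emb (a j) * w j.
have spanD x y : span x -> span y -> span (x + y).
  case=> a -> [a' ->]; exists (fun j => a j + a' j).
  by rewrite -big_split; apply: eq_bigr => j _; rewrite rmorphD mulrDl.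
have spanE e c : e \in E -> span (emb c * mmap1 xi e).
  move=> eE; have ie : (index e E < size E)%N by rewrite index_mem.
  exists (fun j => if j == Ordinal ie then c else 0).
  rewrite (bigD1 (Ordinal ie)) //= eqxx big1 ?addr0 => [|j /negPf->].
    by rewrite /w nth_index.
  by rewrite rmorph0 mul0r.
have [tau etau] : exists tau, mmap1 xi b / mmap emb xi f = emb tau.
  have [c cg] : exists c, c \in msupp g by exists (mlead g); rewrite mlead_supp.
  have E0 : (0 < size E)%N.
    suff : (\sum_(x <- nseq k b) x + c)%MM \in E by case: (E).
    apply/support_sumsP; exists (nseq k b), c; split; rewrite ?size_nseq //.
    by move=> x /nseqP[->].
  apply: (scalar_eigenvalue (w := w) (j0 := Ordinal E0)); first exact: mmap1_neq0.
  move=> j; have jE : nth 0%MM E j \in E := mem_nth 0%MM (ltn_ord j).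
  have [bs [c' [s1 s2 s3 ej]]] := support_sumsP _ _ _ _ jE.
  have [||bs' [s [t1 t2 t3 t4]]] := @dedekind_mertens _ _ f g (b :: bs) c' _ _ s3.
  - by rewrite /= s1 kE.
  - by move=> x; rewrite inE => /predU1P[->|/s2].
  have [v vg ev] := hs s t3.
  have -> : mmap1 xi b / mmap emb xi f * w j =
      mmap1 xi (\sum_(x <- bs') x)%MM * mmap emb xi v.
    have e1 : mmap1 xi b * w j =
        mmap1 xi (\sum_(x <- bs') x)%MM * (mmap emb xi f * mmap emb xi v).
      by rewrite -ev -!mmap1D -t4 big_cons ej addmA.
    by rewrite mulrAC e1 mulrCA mulrC mulKf.
  rewrite /mmap mulr_sumr.
  suff aux (r : seq 'X_{1..n}) : {subset r <= msupp v} -> span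
      (\sum_(m <- r) mmap1 xi (\sum_(x <- bs') x)%MM * (emb v@_m * mmap1 xi m)).
    exact: aux.
  elim: r => [|m r IH] hr.
    by exists (fun=> 0); rewrite big_nil big1 // => i _; rewrite rmorph0 mul0r.
  rewrite big_cons; apply: spanD; last by apply: IH => x xr; apply: hr; rewrite inE xr orbT.
  rewrite mulrCA -mmap1D; apply: spanE; apply/support_sumsP.
  exists bs', m; split=> //; last by apply/vg/hr; rewrite inE eqxx.
  by case: t1 => ->.
by exists tau; rewrite -etau divfK.
Qed.

(** * The shape of the supports *)

Section Primitive.
Variable n : nat.
Implicit Types a u v w : 'I_n -> int.

Lemma primitive_direction a i0 : a i0 != 0 -> exists g v u,
  [/\ forall i, a i = g * v i, g != 0 & \sum_i u i * v i = 1].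
Proof.
move=> ai0.
have [g [u [hg eg]]] : exists g u,
    (forall i, i \in enum 'I_n -> (g %| a i)%Z) /\ g = \sum_j u j * a j.
  elim: (enum 'I_n) => [|i r [g [u [hg eg]]]].
    by exists 0, (fun=> 0); rewrite big1 // => j _; rewrite mul0r.
  have [al [be e]] := Bezoutz (a i) g.
  exists (gcdz (a i) g), (fun j => (j == i)%:R * al + be * u j); split.
    move=> j; rewrite inE => /predU1P[->|/hg]; first exact: dvdz_gcdl.
    by apply: dvdz_trans; exact: dvdz_gcdr.
  under eq_bigr do rewrite mulrDl -!mulrA.
  rewrite big_split /= -mulr_sumr -eg -e; congr (_ + _).
  by rewrite (bigD1 i) //= eqxx mul1r big1 ?addr0 // => j /negPf->; rewrite mul0r.
have ag i : a i = (a i %/ g)%Z * g by rewrite divzK // hg // mem_enum.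
have g0 : g != 0 by apply: contraNneq ai0 => z; rewrite ag z mulr0.
exists g, (fun i => (a i %/ g)%Z), u; split=> // [i|].
  by rewrite mulrC.
apply: (mulfI g0); rewrite mulr1 [RHS]eg mulr_sumr; apply: eq_bigr => i _.
by rewrite mulrCA [g * _]mulrC -ag.
Qed.

(** The factor is [t = \sum_k u k * w k], by the Bezout identity for [v]. *)
Lemma primitive_multiple v u w i0 :
  \sum_i u i * v i = 1 -> v i0 != 0 ->
  (forall j, v i0 * w j = w i0 * v j) -> exists t, forall j, w j = t * v j.
Proof.
move=> uv vi0 h; exists (\sum_k u k * w k) => j; apply: (mulfI vi0).
rewrite h mulr_suml mulr_sumr -[w i0 * v j]mul1r -uv mulr_suml.
apply: eq_bigr => k _; transitivity (u k * v j * (w i0 * v k)); first by ring.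
by rewrite -h; ring.
Qed.

End Primitive.

Definition vplus n (v : 'I_n -> int) : 'X_{1..n} :=
  [multinom (if v i is Posz k then k else 0%N) | i < n].

Definition vminus n (v : 'I_n -> int) : 'X_{1..n} :=
  [multinom (if v i is Negz k then k.+1 else 0%N) | i < n].

Lemma vplus_vminus n (v : 'I_n -> int) i :
  (vplus v i)%:Z - (vminus v i)%:Z = v i.
Proof. by rewrite !mnmE; case: (v i) => k; lia. Qed.

Lemma vplus_or_vminus n (v : 'I_n -> int) i : vplus v i = 0%N \/ vminus v i = 0%N.
Proof. by rewrite !mnmE; case: (v i) => k; [right|left]. Qed.

Section ConstantRatios.
Variables (C : closedFieldType) (L : fieldType) (emb : {rmorphism C -> L}).
Variables (n : nat) (xi : 'I_n -> L) (i0 : 'I_n).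
Hypothesis xi0 : forall i, xi i != 0.
Hypothesis indep : forall (m1 m2 : 'X_{1..n}) c, m1 i0 = m2 i0 ->
  mmap1 xi m1 = emb c * mmap1 xi m2 -> m1 = m2.
Implicit Types b c m : 'X_{1..n}.

Definition const_ratio m1 m2 := exists a, mmap1 xi m1 = emb a * mmap1 xi m2.

(** The exponents of constant monomial ratios form a group of rank one, as
    the coordinate [i0] is injective on it. *)
Lemma const_ratio_parallel b b' c c' j :
  const_ratio b b' -> const_ratio c c' ->
  ((b i0)%:Z - (b' i0)%:Z) * ((c j)%:Z - (c' j)%:Z) =
  ((c i0)%:Z - (c' i0)%:Z) * ((b j)%:Z - (b' j)%:Z).
Proof.
case=> r er [s es].
have r0 : r != 0.
  by apply: contraTneq (mmap1_neq0 b xi0) => z; rewrite er z rmorph0 mul0r eqxx.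
have s0 : s != 0.
  by apply: contraTneq (mmap1_neq0 c xi0) => z; rewrite es z rmorph0 mul0r eqxx.
have key : (b *+ c i0 + b' *+ c' i0 + (c *+ b' i0 + c' *+ b i0))%MM =
           (b *+ c' i0 + b' *+ c i0 + (c *+ b i0 + c' *+ b' i0))%MM.
  apply: (indep (c := r ^+ c i0 * s ^+ b' i0 / (r ^+ c' i0 * s ^+ b i0))).
    by rewrite !(mnmDE, mulmnE); lia.
  have rs0 : emb (r ^+ c' i0 * s ^+ b i0) != 0 by rewrite fmorph_eq0 mulf_neq0 ?expf_neq0.
  rewrite rmorphM fmorphV /= mulrAC; apply: (mulIf rs0); rewrite divfK //.
  rewrite !mmap1D !mmap1Mn er es !rmorphM /= !rmorphXn /= !exprMn; ring.
move/(congr1 (fun m => m j)): key; rewrite !(mnmDE, mulmnE) => key.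
by have := congr1 Posz key; rewrite !PoszD !PoszM => kk; lia.
Qed.

(** A polynomial supported on a line is a polynomial in one monomial, so that
    at a zero this monomial is a root of a polynomial over [C], hence a
    constant. *)
Lemma line_zero_const (f : {mpoly C[n]}) (v : 'I_n -> int) b0 i :
    mmap emb xi f = 0 -> b0 \in msupp f -> 0 < v i ->
    (forall b, b \in msupp f -> exists t : nat,
       forall j, (b j)%:Z = (b0 j)%:Z + t%:Z * v j) ->
  const_ratio (vplus v) (vminus v).
Proof.
move=> f0 b0f vi hb; pose t b := ((b i - b0 i) %/ `|v i|)%N.
have tE b : b \in msupp f ->
    (b + vminus v *+ t b)%MM = (b0 + vplus v *+ t b)%MM.
  move=> /hb[k hk]; have -> : t b = k.
    rewrite /t; have -> : (b i - b0 i = k * `|v i|)%N by have := hk i; nia.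
    by rewrite mulnK //; lia.
  apply/mnmP=> j; rewrite !(mnmDE, mulmnE).
  by have := hk j; rewrite -(vplus_vminus v j); nia.
have tinj b b' : b \in msupp f -> b' \in msupp f -> t b = t b' -> b = b'.
  move=> /tE e /tE e' tt; apply/mnmP=> j.
  move/mnmP/(_ j): e; move/mnmP/(_ j): e'; rewrite !(mnmDE, mulmnE) tt; lia.
pose phi : {poly C} := \sum_(b <- msupp f) f@_b *: 'X^(t b).
have phi0 : phi != 0.
  apply/negP=> /eqP /(congr1 (fun p : {poly C} => p`_(t b0))).
  rewrite coef0 coef_sum (bigD1_seq b0) ?msupp_uniq //= coefZ coefXn eqxx mulr1.
  rewrite big_seq_cond big1 ?addr0 => [z|b /andP[bf bb]].
    by move: b0f; rewrite mcoeff_msupp z eqxx.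
  rewrite coefZ coefXn; case: eqP => [/esym e|]; rewrite ?mulr0 //.
  by rewrite (tinj _ _ bf b0f e) eqxx in bb.
pose th := mmap1 xi (vplus v) / mmap1 xi (vminus v).
have m0 m := mmap1_neq0 m xi0.
have : root (map_poly emb phi) th.
  rewrite rootE rmorph_sum horner_sum -(mulrI_eq0 _ (lregP (m0 b0))) mulr_sumr.
  apply/eqP; rewrite -[RHS]f0 /mmap big_seq [RHS]big_seq; apply: eq_bigr => b bf.
  rewrite /= map_polyZ map_polyXn /= hornerZ hornerXn mulrCA; congr (_ * _).
  have := congr1 (mmap1 xi) (tE b bf); rewrite !mmap1D !mmap1Mn /th expr_div_n.
  move=> e; apply: (mulIf (expf_neq0 (t b) (m0 (vminus v)))).
  by rewrite e mulrA divfK // expf_neq0.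
have [r ephi] := closed_field_poly_normal phi; rewrite ephi map_polyZ rootZ; last first.
  by rewrite fmorph_eq0 lead_coef_eq0.
rewrite rmorph_prod rootE horner_prod prodf_seq_eq0 => /hasP[z _].
rewrite /= rmorphB /= map_polyX map_polyC hornerXsubC subr_eq0 => /eqP e.
by exists z; rewrite -e divfK.
Qed.

End ConstantRatios.

Lemma seq_argmin (T : eqType) (f : T -> nat) (s : seq T) x : x \in s ->
  exists2 y, y \in s & forall z, z \in s -> (f y <= f z)%N.
Proof.
elim: s x => // a s IH x _; case: s IH => [|b s] IH.
  by exists a; rewrite ?inE // => z; rewrite inE => /eqP->.
have [y ys hy] := IH b (mem_head _ _).
have [le|lt] := leqP (f a) (f y).
  exists a; first by rewrite inE eqxx.
  by move=> z; rewrite inE => /predU1P[->//|/hy]; apply: leq_trans.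
exists y; first by rewrite inE ys orbT.
by move=> z; rewrite inE => /predU1P[->|/hy//]; apply: ltnW.
Qed.

Lemma seq_argmax (T : eqType) (f : T -> nat) (s : seq T) x : x \in s ->
  exists2 y, y \in s & forall z, z \in s -> (f z <= f y)%N.
Proof.
elim: s x => // a s IH x _; case: s IH => [|b s] IH.
  by exists a; rewrite ?inE // => z; rewrite inE => /eqP->.
have [y ys hy] := IH b (mem_head _ _).
have [le|lt] := leqP (f y) (f a).
  exists a; first by rewrite inE eqxx.
  by move=> z; rewrite inE => /predU1P[->//|/hy h]; apply: leq_trans h le.
exists y; first by rewrite inE ys orbT.
by move=> z; rewrite inE => /predU1P[->|/hy//]; apply: ltnW.
Qed.

(** A sum of two exponents that arises in one way only cannot cancel. *)
Lemma msuppM_corner (C : idomainType) n (f g : {mpoly C[n]}) (b0 c0 : 'X_{1..n}) :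
    b0 \in msupp f -> c0 \in msupp g ->
    (forall b c : 'X_{1..n}, b \in msupp f -> c \in msupp g ->
       (b + c = b0 + c0)%MM -> b = b0) ->
  (b0 + c0)%MM \in msupp (f * g).
Proof.
move=> bf cg uni; rewrite mcoeff_msupp mpolyME raddf_sum.
have pin : (b0, c0) \in [seq (b, c) | b <- msupp f, c <- msupp g].
  exact: allpairs_f.
rewrite (bigD1_seq (b0, c0)) ?allpairs_uniq ?msupp_uniq //; last by move=> [? ?] [? ?].
rewrite /= mcoeffZ mcoeffX eqxx mulr1 big_seq_cond big1 ?addr0.
  by rewrite mulf_neq0 // -mcoeff_msupp.
move=> [b c] /andP[/allpairsP[[b' c'] /= [bf' cg' [-> ->]]] ne].
rewrite mcoeffZ mcoeffX; case: eqP => [e|]; rewrite ?mulr0 //.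
have eb := uni b' c' bf' cg' e; case/eqP: ne; rewrite eb; congr pair.
by apply: (@addmI _ b0); rewrite -{1}eb.
Qed.

(** At a generic zero of [g] the monomials of [f] have constant ratios, so the
    support of [f] lies on a line; likewise for [g]. The two lines are parallel:
    at a generic zero of [f], the monomial directing the support of [f] is
    constant by [line_zero_const], and so are the ratios of the monomials of
    [g], while constant monomials all have parallel exponents. *)
Lemma supports_on_line (C : closedFieldType) n (f g : {mpoly C[n]})
    (b1 b2 c1 c2 : 'X_{1..n}) :
    b1 \in msupp f -> b2 \in msupp f -> b1 != b2 ->
    c1 \in msupp g -> c2 \in msupp g -> c1 != c2 ->
    (forall i, exists2 m : 'X_{1..n}, m \in msupp (f * g) & m i = 0%N) ->
    (forall s, s \in msupp (f * g) -> exists u v : {mpoly C[n]},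
      [/\ {subset msupp u <= msupp f}, {subset msupp v <= msupp g}
        & 'X_[s] = u * g + f * v]) ->
  exists (v u : 'I_n -> int) i0, [/\ \sum_i u i * v i = 1, 0 < v i0,
    forall b b', b \in msupp f -> b' \in msupp f ->
       exists t, forall j, (b j)%:Z - (b' j)%:Z = t * v j
  & forall c c', c \in msupp g -> c' \in msupp g ->
       exists t, forall j, (c j)%:Z - (c' j)%:Z = t * v j].
Proof.
have ratios (f' g' : {mpoly C[n]}) (e1 e2 : 'X_{1..n}) :
    e1 \in msupp g' -> e2 \in msupp g' -> e1 != e2 ->
    (forall i, exists2 m : 'X_{1..n}, m \in msupp (f' * g') & m i = 0%N) ->
    (forall s, s \in msupp (f' * g') -> exists u v : {mpoly C[n]},
      {subset msupp v <= msupp g'} /\ 'X_[s] = u * g' + f' * v) ->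
  exists (L : fieldType) (emb : {rmorphism C -> L}) (xi : 'I_n -> L) i0,
    [/\ mmap emb xi g' = 0, forall i, xi i != 0,
      forall (m1 m2 : 'X_{1..n}) c, m1 i0 = m2 i0 ->
          mmap1 xi m1 = emb c * mmap1 xi m2 -> m1 = m2
      & forall b b', b \in msupp f' -> b' \in msupp f' -> const_ratio emb xi b b'].
  move=> e1g e2g e12 cop hs.
  have [e0 e0g e00] : exists2 e, e \in msupp g' & e != 0%MM.
    have [e10|] := eqVneq e1 0%MM; last by exists e1.
    by exists e2 => //; rewrite -e10 eq_sym.
  have [i|L [emb [xi [i0 [gxi xi0 indep]]]]] := @generic_zero C n g' e0 e0g e00.
    have [m /msuppM_le /allpairsP[[b c] /= [_ cg ->]]] := cop i.
    rewrite mnmDE => /eqP; rewrite addn_eq0 => /andP[_ /eqP ci].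
    by exists c.
  exists L, emb, xi, i0; split=> //.
  have hs' s : s \in msupp (f' * g') -> exists2 v : {mpoly C[n]},
      {subset msupp v <= msupp g'} & mmap1 xi s = mmap emb xi f' * mmap emb xi v.
    case/hs=> u [v [vg e]]; exists v => //.
    by rewrite -(mmapX xi emb) e rmorphD !rmorphM /= gxi mulr0 add0r.
  have fxi : mmap emb xi f' != 0.
    have [m mfg _] := cop i0; have [v _ e] := hs' m mfg.
    by apply: contraTneq (mmap1_neq0 m xi0) => z; rewrite e z mul0r eqxx.
  have g0 : g' != 0 by apply: contraTneq e1g => ->; rewrite msupp0.
  move=> b b' bf bf'.
  have [r er] := monomial_ratio_const xi0 g0 fxi hs' bf.
  have [r' er'] := monomial_ratio_const xi0 g0 fxi hs' bf'.
  have r'0 : emb r' != 0.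
    by apply: contraTneq (mmap1_neq0 b' xi0) => z; rewrite er' z mul0r eqxx.
  exists (r / r'); rewrite er er' rmorphM fmorphV mulrA divfK //.
move=> b1f b2f b12 c1g c2g c12 cop hs.
have [|L [emb [xi [i0 [_ xi0 ind hB]]]]] := ratios f g c1 c2 c1g c2g c12 cop.
  by move=> s /hs[u [v [_ h1 h2]]]; exists u, v.
have [||L' [emb' [xi' [i1 [fxi xi0' ind' hG]]]]] := ratios g f b1 b2 b1f b2f b12.
- by move=> i; rewrite mulrC; apply: cop.
- move=> s; rewrite mulrC => /hs[u [v [h1 h2 e]]]; exists v, u; split=> //.
  by rewrite e addrC [u * g]mulrC [f * v]mulrC.
have [b0 b0f minb] := seq_argmin (fun b : 'X_{1..n} => b i0) b1f.
have inj b b' : b \in msupp f -> b' \in msupp f -> b i0 = b' i0 -> b = b'.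
  by move=> bf bf' e; have [a] := hB _ _ bf bf'; apply: ind.
have [b3 b3f b30] : exists2 b, b \in msupp f & (b0 i0 < b i0)%N.
  have [e|ne] := eqVneq b1 b0.
    exists b2 => //; rewrite ltn_neqAle minb // andbT.
    by apply: contraNneq b12 => ee; rewrite e (inj b0 b2).
  exists b1 => //; rewrite ltn_neqAle minb // andbT.
  by apply: contraNneq ne => ee; rewrite (inj b0 b1).
pose a j := (b3 j)%:Z - (b0 j)%:Z.
have a0 : a i0 != 0 by rewrite /a; lia.
have [gg [v [u [av gg0 uv]]]] := primitive_direction a0.
wlog vi0 : v u gg av gg0 uv / 0 < v i0 => [hw|].
  have [|le] := boolP (0 < v i0); first exact: (hw v u gg).
  apply: (hw (fun i => - v i) (fun i => - u i) (- gg)).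
  - by move=> i; rewrite mulrNN.
  - by rewrite oppr_eq0.
  - by rewrite -uv; apply: eq_bigr => i _; rewrite mulrNN.
  - by have := av i0; move: a0 le; nia.
have vi00 : v i0 != 0 by apply: contraTneq vi0 => ->.
have lineB b b' : b \in msupp f -> b' \in msupp f ->
    exists t, forall j, (b j)%:Z - (b' j)%:Z = t * v j.
  move=> bf bf'; apply: (primitive_multiple uv vi00) => j.
  have := const_ratio_parallel xi0 ind j (hB _ _ b3f b0f) (hB _ _ bf bf').
  rewrite -/(a i0) -/(a j) !av => e; apply: (mulfI gg0); move: e.
  by move=> e; rewrite mulrA e; ring.
have vpm : const_ratio emb' xi' (vplus v) (vminus v).
  apply: (line_zero_const xi0' fxi b0f vi0) => b bf.
  have [t ht] := lineB b b0 bf b0f.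
  exists `|t|%N => j; have -> : (`|t|%N)%:Z = t.
    by have := ht i0; have := minb b bf; nia.
  by rewrite -ht; lia.
exists v, u, i0; split=> // c c' cg cg'.
have vi1 : v i1 != 0.
  apply/negP=> /eqP z; have [r er] := vpm.
  have : vplus v = vminus v.
    by apply: ind' er; have := vplus_vminus v i1; rewrite z; lia.
  move/mnmP/(_ i0); have := vplus_vminus v i0; lia.
apply: (primitive_multiple uv vi1) => j.
have := const_ratio_parallel xi0' ind' j vpm (hG _ _ cg cg').
by rewrite !vplus_vminus.
Qed.

Section LineArithmetic.
Implicit Types (a b c d t x y : nat) (v r : int).

Lemma line_ge0 a b r v :
  0 < v -> a%:Z - b%:Z = r * v -> (b <= a)%N -> 0 <= r.
Proof. nia. Qed.

Lemma line_le a b c r r' v :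
  0 < v -> a%:Z - c%:Z = r * v -> b%:Z - c%:Z = r' * v -> (a <= b)%N -> r <= r'.
Proof. nia. Qed.

Lemma line_eq0 a b r v : 0 < v -> a%:Z - b%:Z = r * v -> a = b -> r = 0.
Proof. nia. Qed.

Lemma corner_min b c b0 c0 t t' v : 0 < v ->
  b%:Z = b0%:Z + t%:Z * v -> c%:Z = c0%:Z + t'%:Z * v ->
  (b + c = b0 + c0)%N -> t = 0%N.
Proof. nia. Qed.

Lemma corner_max b c b0 c0 b3 c3 t t' d d' v : 0 < v -> (t <= d)%N -> (t' <= d')%N ->
  b%:Z = b0%:Z + t%:Z * v -> c%:Z = c0%:Z + t'%:Z * v ->
  b3%:Z = b0%:Z + d%:Z * v -> c3%:Z = c0%:Z + d'%:Z * v ->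
  (b + c = b3 + c3)%N -> t = d.
Proof.
move=> v0 td td' e1 e1' e3 e3' e.
have : (d%:Z - t%:Z) * v + (d'%:Z - t'%:Z) * v = 0 by lia.
by move: v0 td td'; clear; nia.
Qed.

Lemma line_base b0 c0 b3 c3 d d' t x y : (t <= d + d')%N -> x = 0%N \/ y = 0%N ->
  0 = b0%:Z + c0%:Z + t%:Z * (x%:Z - y%:Z) ->
  b3%:Z = b0%:Z + d%:Z * (x%:Z - y%:Z) -> c3%:Z = c0%:Z + d'%:Z * (x%:Z - y%:Z) ->
  b0%:Z + c0%:Z = (d + d')%:Z * y%:Z.
Proof. by move=> td [->|->]; nia. Qed.

Lemma line_form a b0 c0 d t x y : (t <= d)%N ->
  b0%:Z + c0%:Z = d%:Z * y%:Z ->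
  a%:Z = b0%:Z + c0%:Z + t%:Z * (x%:Z - y%:Z) ->
  a = (x * t + y * (d - t))%N.
Proof. nia. Qed.

End LineArithmetic.

(** The common direction [v] of the supports gives the two monomials: their
    exponents are the positive and the negative part of [v]. The degree [d] is
    the sum of the lengths of the supports of [f] and [g], whence [1 < d]. *)
Lemma two_monomial_form (C : closedFieldType) n (f g : {mpoly C[n]})
    (b1 b2 c1 c2 : 'X_{1..n}) :
    b1 \in msupp f -> b2 \in msupp f -> b1 != b2 ->
    c1 \in msupp g -> c2 \in msupp g -> c1 != c2 ->
    (forall i, exists2 m : 'X_{1..n}, m \in msupp (f * g) & m i = 0%N) ->
    (forall s, s \in msupp (f * g) -> exists u v : {mpoly C[n]},
      [/\ {subset msupp u <= msupp f}, {subset msupp v <= msupp g}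
        & 'X_[s] = u * g + f * v]) ->
  exists (m1 m2 : 'X_{1..n}) (d : nat), [/\ (1 < d)%N,
    forall i, m1 i = 0%N \/ m2 i = 0%N,
    forall s, s \in msupp (f * g) ->
      exists2 k, (k <= d)%N & s = (m1 *+ k + m2 *+ (d - k))%MM,
    (m1 *+ d)%MM \in msupp (f * g) & (m2 *+ d)%MM \in msupp (f * g)].
Proof.
move=> b1f b2f b12 c1g c2g c12 cop hs.
have [v [u [i0 [_ vi0 lineB lineG]]]] :=
  supports_on_line b1f b2f b12 c1g c2g c12 cop hs.
(* the coordinate [i0] increases along the line, so it finds the ends *)
have ends (p : {mpoly C[n]}) (e1 e2 : 'X_{1..n}) :
    e1 \in msupp p -> e2 \in msupp p -> e1 != e2 ->
    (forall b b', b \in msupp p -> b' \in msupp p ->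
       exists t, forall j, (b j)%:Z - (b' j)%:Z = t * v j) ->
  exists (e0 e3 : 'X_{1..n}) (d : nat),
    [/\ e0 \in msupp p, e3 \in msupp p, (0 < d)%N,
        forall e, e \in msupp p -> exists2 t : nat, (t <= d)%N &
          forall j, (e j)%:Z = (e0 j)%:Z + t%:Z * v j
      & forall j, (e3 j)%:Z = (e0 j)%:Z + d%:Z * v j].
  move=> e1p e2p e12 line.
  have [e0 e0p mine] := seq_argmin (fun e : 'X_{1..n} => e i0) e1p.
  have [e3 e3p maxe] := seq_argmax (fun e : 'X_{1..n} => e i0) e1p.
  have [d hd] := line e3 e0 e3p e0p.
  have d0 := line_ge0 vi0 (hd i0) (mine _ e3p).
  have dn : d != 0.
    apply: contraNneq e12 => z; have [t ht] := line e1 e2 e1p e2p.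
    have top e : e \in msupp p -> e i0 = e0 i0.
      move=> ep; apply/eqP; rewrite eqn_leq mine // andbT.
      by have := hd i0; rewrite z mul0r => /eqP; rewrite subr_eq0 => /eqP[<-]; apply: maxe.
    have t0 := line_eq0 vi0 (ht i0) (etrans (top _ e1p) (esym (top _ e2p))).
    apply/eqP/mnmP=> j; have := ht j; rewrite t0 mul0r => /eqP.
    by rewrite subr_eq0 => /eqP[].
  exists e0, e3, `|d|%N; split=> //; first by rewrite absz_gt0.
    move=> e ep; have [t ht] := line e e0 ep e0p.
    have t0 := line_ge0 vi0 (ht i0) (mine _ ep).
    have td := line_le vi0 (ht i0) (hd i0) (maxe _ ep).
    exists `|t|%N; first by rewrite -lez_nat !gez0_abs.
    by move=> j; rewrite gez0_abs // -ht addrC subrK.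
  by move=> j; rewrite gez0_abs // -hd addrC subrK.
have [b0 [b3 [db [b0f b3f db0 hb hb3]]]] := ends f b1 b2 b1f b2f b12 lineB.
have [c0 [c3 [dc [c0g c3g dc0 hc hc3]]]] := ends g c1 c2 c1g c2g c12 lineG.
have corner0 : (b0 + c0)%MM \in msupp (f * g).
  apply: msuppM_corner => // b c bf cg /(congr1 (fun m : 'X_{1..n} => m i0)).
  rewrite !mnmDE; have [t _ ht] := hb _ bf; have [t' _ ht'] := hc _ cg.
  move/(corner_min vi0 (ht i0) (ht' i0)) => t0.
  by apply/mnmP=> j; have := ht j; rewrite t0 mul0r addr0 => -[].
have corner3 : (b3 + c3)%MM \in msupp (f * g).
  apply: msuppM_corner => // b c bf cg /(congr1 (fun m : 'X_{1..n} => m i0)).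
  rewrite !mnmDE; have [t lt ht] := hb _ bf; have [t' lt' ht'] := hc _ cg.
  move/(corner_max vi0 lt lt' (ht i0) (ht' i0) (hb3 i0) (hc3 i0)) => t0.
  by apply/mnmP=> j; apply/eqP; rewrite -eqz_nat ht hb3 t0.
have param s : s \in msupp (f * g) -> exists2 t : nat, (t <= db + dc)%N &
    forall j, (s j)%:Z = (b0 j)%:Z + (c0 j)%:Z + t%:Z * v j.
  move/msuppM_le/allpairsP=> [[b c] /= [bf cg ->]].
  have [t lt ht] := hb _ bf; have [t' lt' ht'] := hc _ cg.
  exists (t + t')%N; first by rewrite leq_add.
  by move=> j; rewrite mnmDE PoszD ht ht' PoszD; ring.
have base j : ((b0 j)%:Z + (c0 j)%:Z = (db + dc)%:Z * (vminus v j)%:Z)%R.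
  have [m mF mj] := cop j; have [t lt ht] := param m mF.
  have := ht j; have := hb3 j; have := hc3 j; rewrite mj -(vplus_vminus v j).
  by move=> e1 e2 e3; apply: line_base lt (vplus_or_vminus v j) e3 e2 e1.
have form (s : 'X_{1..n}) t : (t <= db + dc)%N ->
    (forall j, (s j)%:Z = (b0 j)%:Z + (c0 j)%:Z + t%:Z * v j) ->
    s = (vplus v *+ t + vminus v *+ (db + dc - t))%MM.
  move=> lt ht; apply/mnmP=> j; have := ht j; rewrite -(vplus_vminus v j).
  by rewrite mnmDE !mulmnE; apply: line_form lt (base j).
exists (vplus v), (vminus v), (db + dc)%N; split.
- by rewrite -(addn1 1) leq_add.
- exact: vplus_or_vminus.
- by move=> s /param[t lt ht]; exists t => //; apply: form.
- have -> : (vplus v *+ (db + dc))%MM = (b3 + c3)%MM.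
    rewrite (form (b3 + c3)%MM (db + dc)%N) ?subnn ?mulm0n ?addm0 //.
    by move=> j; rewrite mnmDE PoszD hb3 hc3 PoszD; ring.
  exact: corner3.
- have -> : (vminus v *+ (db + dc))%MM = (b0 + c0)%MM.
    rewrite (form (b0 + c0)%MM 0%N) ?subn0 ?mulm0n ?add0m //.
    by move=> j; rewrite mnmDE PoszD; ring.
  exact: corner0.
Qed.

(** * Monomials and relative primality *)

Section Monomials.
Variables (K : fieldType) (n : nat).
Implicit Types (p q r : {mpoly K[n]}) (m : 'X_{1..n}).

(** A divisor of a monomial is a monomial: leading and last monomials are
    multiplicative, so they agree on each factor. *)
Lemma monomial_factor q r c m :
  c != 0 -> q * r = c *: 'X_[m] -> is_monomial q.
Proof.
move=> c0 e; have qr0 : q * r != 0.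
  rewrite e -mul_mpolyC mulf_neq0 ?mpolyC_eq0 //.
  by rewrite -msize_poly_eq0 msizeX.
have [q0 r0] : q != 0 /\ r != 0.
  by apply/andP; rewrite -negb_or -mulf_eq0.
have supp x : x \in msupp (q * r) -> x = m.
  by rewrite e => /msuppZ_le; rewrite msuppX inE => /eqP.
have top : (mlead q + mlead r)%MM = m.
  by apply: supp; rewrite -mleadM // mlead_supp.
have bot : (mlast q + mlast r)%MM = m.
  apply/supp/msuppM_corner; rewrite ?mlast_supp // => b b' bq br eb.
  apply/eqP; case: (Order.TotalTheory.ltgtP b (mlast q)) (mlast_lemc bq) => // lt _.
  have := lemc_lt_add (mlast_lemc br) lt.
  by rewrite [(b' + b)%MM]addmC [(mlast r + _)%MM]addmC eb Order.POrderTheory.ltxx.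
have eql : mlast q = mlead q.
  apply/eqP; case: (Order.TotalTheory.ltgtP (mlast q) (mlead q)) => // lt.
    have := lemc_lt_add (msupp_le_mlead (mlast_supp r0)) lt.
    by rewrite [(mlast r + _)%MM]addmC [(mlead r + _)%MM]addmC top bot Order.POrderTheory.ltxx.
  by have := msupp_le_mlead (mlast_supp q0); rewrite Order.TotalTheory.leNgt lt.
exists q@_(mlead q), (mlead q); split; first by rewrite mleadc_eq0.
apply/mpolyP=> k; rewrite mcoeffZ mcoeffX; case: eqP => [<-|ne].
  by rewrite mulr1.
rewrite mulr0; apply: memN_msupp_eq0; apply/negP=> kq; case: ne.
by apply/eqP; rewrite Order.POrderTheory.eq_le msupp_le_mlead // -eql mlast_lemc.
Qed.

Lemma nonconst_supp p : (1 < msize p)%N -> exists2 m, m \in msupp p & m != 0%MM.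
Proof.
move=> hp; have p0 : p != 0 by apply: contraTneq hp => ->; rewrite msize0.
exists (mlead p); first exact: mlead_supp.
by rewrite -mdeg_eq0 -lt0n -ltnS mlead_deg.
Qed.

Lemma supp_nonconst p m : m \in msupp p -> m != 0%MM -> (1 < msize p)%N.
Proof.
move=> mp m0; apply: leq_trans (msize_mdeg_lt mp).
by rewrite ltnS lt0n mdeg_eq0.
Qed.

Lemma nonconstMl p q : p * q != 0 -> (1 < msize p)%N -> (1 < msize (p * q))%N.
Proof.
rewrite mulf_eq0 negb_or => /andP[p0 q0] hp; rewrite msizeM //.
have : (0 < msize q)%N by rewrite lt0n msize_poly_eq0.
case: (msize q) => // a _; rewrite addnS /=.
exact: leq_trans hp (leq_addr _ _).
Qed.

Lemma unit_mpolyE p : p != 0 -> (p \is a GRing.unit) = (msize p <= 1)%N.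
Proof.
move=> p0; apply/idP/idP.
  move=> /unitrP[q [e _]]; have q0 : q != 0.
    by apply: contra_eq_neq e => ->; rewrite mul0r eq_sym oner_eq0.
  have := congr1 (fun x : {mpoly K[n]} => msize x) e; rewrite /= msizeM // msize1.
  have : (0 < msize q)%N by rewrite lt0n msize_poly_eq0.
  by case: (msize q) => // a _; rewrite addSn /= => <-; apply: leq_addl.
move/msize1_polyC => ep; rewrite [_ \is a _](_ : _ = mpoly_unit p) //.
rewrite /mpoly_unit -ep eqxx unitfE; apply: contra p0 => /eqP z.
by rewrite ep z mpolyC0.
Qed.

Lemma relatively_prime_no_variable (s : seq {mpoly K[n]}) i :
    relatively_prime s -> (forall p, p \in s -> is_monomial p) ->
  exists2 p, p \in s & exists2 m, m \in msupp p & m i = 0%N.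
Proof.
move=> cop mon; have [//|no] := classic (exists2 p, p \in s &
  exists2 m, m \in msupp p & m i = 0%N).
case: (cop 'X_i); first by rewrite msizeX mdeg1.
move=> p ps; have [c [m [c0 ep]]] := mon p ps.
have mi : (U_(i) <= m)%MM.
  rewrite lep1mP; apply/eqP => z; apply: no; exists p => //; exists m => //.
  by rewrite ep msuppMCX ?inE.
by exists (c *: 'X_[m - U_(i)]); rewrite -scalerAl -mpolyXD submK.
Qed.

Lemma disjoint_monomials_coprime m m' (c c' : K) : c != 0 -> c' != 0 ->
  (forall i, m i = 0%N \/ m' i = 0%N) -> relatively_prime [:: c *: 'X_[m]; c' *: 'X_[m'] : {mpoly K[n]}].
Proof.
move=> c0 c'0 dis p hp dv.
have [r er] : mpoly_dvd p (c *: 'X_[m]) by apply: dv; rewrite inE eqxx.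
have [r' er'] : mpoly_dvd p (c' *: 'X_[m']) by apply: dv; rewrite !inE eqxx orbT.
have [x xp x0] := nonconst_supp hp.
have below a y z : a != 0 -> a *: 'X_[y] = z * p -> forall i, (x i <= y i)%N.
  move=> a0 e; have [b [w [b0 ep]]] : is_monomial p.
    by apply: (@monomial_factor p z a y a0); rewrite mulrC -e.
  move: xp e; rewrite ep msuppMCX // inE => /eqP->; rewrite -scalerAr => e i.
  have : y \in msupp (z * 'X_[w]).
    have : y \in msupp (b *: (z * 'X_[w])) by rewrite -e msuppMCX ?inE.
    by move/msuppZ_le.
  rewrite (perm_mem (msuppMX _ _)) => /mapP[k _ ->].
  by rewrite mnmDE leq_addr.
case/eqP: x0; apply/mnmP=> i; rewrite mnm0E; apply/eqP; rewrite -leqn0.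
by case: (dis i) => <-; [apply: (below _ _ _ c0 er) | apply: (below _ _ _ c'0 er')].
Qed.

End Monomials.

(** * Factorial rings *)

Definition dvdr (R : idomainType) (a b : R) : Prop := exists c, b = c * a.

Definition prime_elt (R : idomainType) (p : R) : Prop :=
  [/\ p != 0, p \isn't a GRing.unit
    & forall a b, dvdr p (a * b) -> dvdr p a \/ dvdr p b].

Definition factorial (R : idomainType) : Prop :=
  forall a : R, a != 0 -> exists (u : R) (s : seq R),
    [/\ u \is a GRing.unit, forall p, p \in s -> prime_elt p
      & a = u * \prod_(p <- s) p].

Section Divisibility.
Variable R : idomainType.
Implicit Types (a b c d p : R) (s : seq R).

Lemma dvdr_mull a b c : dvdr a c -> dvdr a (b * c).
Proof. by case=> d ->; exists (b * d); rewrite mulrA. Qed.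

Lemma dvdr_mulr a b c : dvdr a b -> dvdr a (b * c).
Proof. by move=> h; rewrite mulrC; apply: dvdr_mull. Qed.

Lemma dvdr_add a b c : dvdr a b -> dvdr a c -> dvdr a (b + c).
Proof. by case=> d -> [e ->]; exists (d + e); rewrite mulrDl. Qed.

Lemma dvdr_sub a b c : dvdr a b -> dvdr a c -> dvdr a (b - c).
Proof. by case=> d -> [e ->]; exists (d - e); rewrite mulrBl. Qed.

(** Each prime in turn is cancelled against the factor, [q] or [d], that it
    divides. *)
Lemma split_prime_prod s a q d :
    (forall p, p \in s -> prime_elt p) ->
    (\prod_(p <- s) p) * a = q * d ->
  exists s1 s2 q1 d1,
    [/\ (size s1 + size s2 = size s)%N,
        (forall p, p \in s1 -> p \in s) /\ (forall p, p \in s2 -> p \in s),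
        q = (\prod_(p <- s1) p) * q1, d = (\prod_(p <- s2) p) * d1
      & a = q1 * d1].
Proof.
elim: s a q d => [|p s IH] a q d sP.
  rewrite big_nil mul1r => ->; exists [::], [::], q, d.
  by split; rewrite ?big_nil ?mul1r //; split.
have [p0 _ pP] : prime_elt p by apply: sP; rewrite inE eqxx.
have sP' r : r \in s -> prime_elt r by move=> rs; apply: sP; rewrite inE rs orbT.
rewrite big_cons -mulrA => e.
have : dvdr p (q * d) by rewrite -e; apply: dvdr_mulr; exists 1; rewrite mul1r.
case/pP=> -[c ec].
  have : \prod_(r <- s) r * a = c * d.
    by apply: (mulfI p0); rewrite e ec mulrA (mulrC p).
  case/(IH _ _ _ sP')=> s1 [s2 [q1 [d1 [sz [h1 h2] e1 -> ea]]]].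
  exists (p :: s1), s2, q1, d1; split=> //=; first by rewrite addSn sz.
    split=> r; rewrite !inE; last by move/h2->; rewrite orbT.
    by case/orP=> [->//|/h1->]; rewrite orbT.
  by rewrite big_cons ec e1 mulrC mulrA.
have : \prod_(r <- s) r * a = q * c.
  by apply: (mulfI p0); rewrite e ec [RHS]mulrC -mulrA.
case/(IH _ _ _ sP')=> s1 [s2 [q1 [d1 [sz [h1 h2] -> e1 ea]]]].
exists s1, (p :: s2), q1, d1; split=> //=; first by rewrite addnS sz.
  split=> r; rewrite !inE; first by move/h1->; rewrite orbT.
  by case/orP=> [->//|/h2->]; rewrite orbT.
by rewrite big_cons ec e1 mulrC mulrA.
Qed.

Lemma prime_exp_dvdl p e u g :
  prime_elt p -> ~ dvdr p g -> dvdr (p ^+ e) (u * g) -> dvdr (p ^+ e) u.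
Proof.
move=> [p0 pU pP] pg; elim: e u => [|e IH] u; first by exists u; rewrite mulr1.
case=> c ec; have [|[d ed]|//] := pP u g.
  by exists (c * p ^+ e); rewrite ec exprSr mulrA.
have : dvdr (p ^+ e) (d * g).
  exists c; apply: (mulIf p0).
  by rewrite mulrAC -ed ec exprSr mulrA.
by case/IH=> c' ec'; exists c'; rewrite ed ec' exprSr mulrA.
Qed.

End Divisibility.

Section FactorialPoly.
Variable R : idomainType.
Implicit Types (f g h q : {poly R}) (c : R).

(** Gauss: if [c] divides [a * b], it divides the product of the leading
    coefficients, hence one of the two, and that leading term can be removed
    without affecting what [c] divides. *)
Lemma prime_polyC c : prime_elt c -> prime_elt c%:P.
Proof.
move=> [c0 cU cP]; split; first by rewrite polyC_eq0.
  apply: contra cU; rewrite poly_unitE size_polyC c0 coefC /=.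
  by [].
move=> a b; have [m] := ubnP (size a + size b); elim: m a b => // m IH a b hm.
have [->|a0] := eqVneq a 0; first by left; exists 0; rewrite mul0r.
have [->|b0] := eqVneq b 0; first by right; exists 0; rewrite mul0r.
move=> dab.
have step f : f != 0 -> dvdr c (lead_coef f) ->
    exists f', (size f' < size f)%N /\ dvdr c%:P (f - f').
  move=> f0 [e ee]; exists (f - lead_coef f *: 'X^((size f).-1)); split.
    rewrite -[X in (_ < X)%N](prednK (_ : 0 < size f)%N) ?size_poly_gt0 // ltnS.
    apply/leq_sizeP=> j hj; rewrite coefB coefZ coefXn.
    case: (ltngtP j (size f).-1) hj => // [hj _|-> _].
      by rewrite mulr0 subr0 nth_default // -(prednK (_ : 0 < size f)%N) ?size_poly_gt0.
    by rewrite mulr1 subrr.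
  exists (e *: 'X^((size f).-1)); rewrite opprB addrC subrK ee.
  by rewrite -!mul_polyC polyCM -!mulrA [_ * c%:P]mulrC.
have : dvdr c (lead_coef a * lead_coef b).
  by case: dab => d ed; exists (lead_coef d); rewrite -lead_coefM ed lead_coefM lead_coefC.
case/cP=> [/(step a a0)|/(step b b0)] [f' [hs [d ed]]].
- have : dvdr c%:P (f' * b).
    have -> : f' * b = a * b - (a - f') * b by rewrite mulrBl opprB addrC subrK.
    by apply: dvdr_sub => //; apply: dvdr_mulr; exists d.
  case/IH; [|move=> hf; left|by right].
    by apply: leq_trans (_ : _ <= size a + size b)%N _; rewrite ?ltn_add2r // -ltnS.
  by rewrite -(subrK f' a); apply: dvdr_add => //; exists d.
- have : dvdr c%:P (a * f').
    have -> : a * f' = a * b - a * (b - f') by rewrite mulrBr opprB addrC subrK.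
    by apply: dvdr_sub => //; apply: dvdr_mull; exists d.
  case/IH; [|by left|move=> hf; right].
    by apply: leq_trans (_ : _ <= size a + size b)%N _; rewrite ?ltn_add2l // -ltnS.
  by rewrite -(subrK f' b); apply: dvdr_add => //; exists d.
Qed.

(** Euclid's algorithm, with pseudo-division because [R] is not a field: when
    a combination [d] of [f] and [g] leaves a remainder, the remainder is a
    combination of smaller degree. *)
Lemma pseudo_gcd f g : f != 0 -> exists (a b d q1 q2 : {poly R}) (c1 c2 : R),
  [/\ d = a * f + b * g, c1 != 0, c2 != 0, c1 *: f = q1 * d & c2 *: g = q2 * d].
Proof.
move=> f0.
suff main m (d a b : {poly R}) : (size d < m)%N -> d != 0 -> d = a * f + b * g ->
    exists (a b d q1 q2 : {poly R}) (c1 c2 : R),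
  [/\ d = a * f + b * g, c1 != 0, c2 != 0, c1 *: f = q1 * d & c2 *: g = q2 * d].
  by apply: (main _ f 1 0 (ltnSn _) f0); rewrite mul1r mul0r addr0.
elim: m d a b => // m IH d a b hs d0 ed.
have lc k : lead_coef d ^+ k != 0 by rewrite expf_neq0 // lead_coef_eq0.
pose r1 := Pdiv.Ring.rmodp f d; pose r2 := Pdiv.Ring.rmodp g d.
have e1 := Pdiv.ComRing.rdivp_eq d f; have e2 := Pdiv.ComRing.rdivp_eq d g.
have hr p : (size (Pdiv.Ring.rmodp p d) < m)%N.
  by apply: leq_trans (Pdiv.Ring.ltn_rmodpN0 p d0) _.
have [z1|nz1] := eqVneq r1 0; last first.
  apply: (IH r1 ((lead_coef d ^+ Pdiv.Ring.rscalp f d)%:P - Pdiv.Ring.rdivp f d * a)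
     (- (Pdiv.Ring.rdivp f d * b))) => //; first exact: hr.
  rewrite mulrBl mul_polyC e1 mulNr -addrA -opprD -!mulrA -mulrDr -ed.
  by rewrite addrAC subrr add0r.
have [z2|nz2] := eqVneq r2 0; last first.
  apply: (IH r2 (- (Pdiv.Ring.rdivp g d * a))
     ((lead_coef d ^+ Pdiv.Ring.rscalp g d)%:P - Pdiv.Ring.rdivp g d * b)) => //; first exact: hr.
  rewrite mulrBl mul_polyC e2 mulNr [- _ + _]addrC -addrA -opprD -!mulrA -mulrDr.
  by rewrite [b * g + _]addrC -ed addrAC subrr add0r.
exists a, b, d, (Pdiv.Ring.rdivp f d), (Pdiv.Ring.rdivp g d), 
  (lead_coef d ^+ Pdiv.Ring.rscalp f d), (lead_coef d ^+ Pdiv.Ring.rscalp g d).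
by split=> //; rewrite ?e1 ?e2 -/r1 -/r2 ?z1 ?z2 addr0.
Qed.

Hypothesis facR : factorial R.

(** The primes of [R] stay prime in [{poly R}], so the constant [c] can be
    cancelled against constant factors of [q] and [d]. *)
Lemma cancel_const c f q d : c != 0 -> c *: f = q * d ->
  exists c1 c2 q1 d1, [/\ q = c1 *: q1, d = c2 *: d1, c2 != 0 & f = q1 * d1].
Proof.
move=> c0; have [u [s [uU sP ec]]] := facR c0.
rewrite -mul_polyC ec polyCM rmorph_prod /= -mulrA => e.
have : \prod_(p <- [seq x%:P | x <- s]) p * f = (u^-1 *: q) * d.
  by rewrite big_map -scalerAl -e mul_polyC scalerA mulVr // scale1r.
case/split_prime_prod=> [p /mapP[x xs ->]|]; first exact/prime_polyC/sP.
move=> s1 [s2 [q1 [d1 [_ [h1 h2] eq ed ->]]]].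
have C (s' : seq {poly R}) :
    (forall p, p \in s' -> p \in [seq x%:P | x <- s]) ->
  exists2 x : R, x != 0 & \prod_(p <- s') p = x%:P.
  elim: s' => [|p s' IH] hs; first by exists 1; rewrite ?oner_eq0 // big_nil.
  have [|x x0 ex] := IH; first by move=> r rs; apply: hs; rewrite inE rs orbT.
  have /hs/mapP[y ys ey] : p \in p :: s' by rewrite inE eqxx.
  have [y0 _ _] := sP _ ys.
  by exists (y * x); rewrite ?mulf_neq0 // big_cons ex ey polyCM.
have [x1 x10 ex1] := C _ h1; have [x2 x20 ex2] := C _ h2.
exists (u * x1), x2, q1, d1; split=> //; last by rewrite ed ex2 mul_polyC.
by rewrite -scalerA -mul_polyC -[x1 *: q1]mul_polyC -ex1 -eq mul_polyC scalerA mulrV // scale1r.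
Qed.

(** Let [f] divide [g * h], and let [d = a f + b g] divide [f] and [g] up to
    constants. As [f] is irreducible, [d] is [f] or [1] up to a constant. In
    the former case [f] divides [g]; in the latter it divides [d h], and
    constants can be cancelled. *)
Lemma irreducible_poly_prime f : (1 < size f)%N ->
    (forall g h, f = g * h -> g \is a GRing.unit \/ h \is a GRing.unit) ->
  prime_elt f.
Proof.
move=> sf irr; have f0 : f != 0 by rewrite -size_poly_gt0 ltnW.
split=> //; first by rewrite poly_unitE negb_and; case: ltngtP sf.
move=> g h [k ek].
have [a [b [d [q1 [q2 [c1 [c2 [ed c10 c20 e1 e2]]]]]]]] := pseudo_gcd g f0.
have [x [y [q [d1 [eq1 ed1 y0 ef]]]]] := cancel_const c10 e1.
case: (irr _ _ ef) => [qU|dU].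
  (* here [d] is a constant times [f] *)
- left; have : c2 *: g = (y *: (q2 * q^-1)) * f.
    by rewrite e2 ed1 ef -scalerAr -scalerAl mulrA mulrVK.
  case/(cancel_const c20)=> x' [y' [g1 [f1 [_ ef1 y'0 ->]]]].
  have : f = y'%:P * f1 by rewrite mul_polyC.
  case/irr=> [yU|f1U].
    exists (g1 * y'%:P^-1); rewrite -mulrA; congr (_ * _).
    by rewrite [in RHS]ef1 -mul_polyC mulrA mulVr // mul1r.
  move: sf f1U; rewrite ef1 size_scale // poly_unitE.
  by case: ltngtP.
  (* here [d] is a constant *)
- right; have := dU; rewrite poly_unitE => /andP[/size_poly1P[z z0 ez] _].
  have : (y * z) *: h = (a * h + b * k) * f.
    have -> : (a * h + b * k) * f = d * h.
      by rewrite ed !mulrDl -!mulrA -ek [h * f]mulrC.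
    by rewrite ed1 ez -scalerAl mul_polyC scalerA.
  case/cancel_const; first by rewrite mulf_neq0.
  move=> x' [y' [g1 [f1 [_ ef1 y'0 ->]]]].
  have : f = y'%:P * f1 by rewrite mul_polyC.
  case/irr=> [yU|f1U].
    exists (g1 * y'%:P^-1); rewrite -mulrA; congr (_ * _).
    by rewrite [in RHS]ef1 -mul_polyC mulrA mulVr // mul1r.
  move: sf f1U; rewrite ef1 size_scale // poly_unitE.
  by case: ltngtP.
Qed.

End FactorialPoly.

Section FactorialRings.
Variable R : idomainType.
Hypothesis facR : factorial R.

(** Splitting terminates because each factor takes with it either some of the
    degree or some of the primes of the leading coefficient. *)
Lemma factorial_poly : factorial {poly R}.
Proof.
suff main m (f : {poly R}) u s : (size s + size f < m)%N -> f != 0 ->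
    u \is a GRing.unit -> (forall p, p \in s -> prime_elt p) ->
    lead_coef f = u * \prod_(p <- s) p ->
  exists (v : {poly R}) (t : seq {poly R}),
    [/\ v \is a GRing.unit, forall p, p \in t -> prime_elt p
      & f = v * \prod_(p <- t) p].
  move=> f f0; have : lead_coef f != 0 by rewrite lead_coef_eq0.
  by case/facR=> u [s [uU sP e]]; apply: (main _ f u s (ltnSn _)).
elim: m f u s => // m IH f u s; rewrite ltnS => hm f0 uU sP lf.
case: (leqP (size f) 1) => [/size1_polyC ef|sf].
  have c0 : f`_0 != 0 by apply: contra f0 => /eqP z; rewrite ef z.
  have [v [t [vU tP ev]]] := facR c0; exists v%:P, [seq x%:P | x <- t].
  split; first by rewrite poly_unitE size_polyC coefC eqxx vU (_ : v != 0) //; apply: contraTneq vU => ->; rewrite unitr0.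
    by move=> p /mapP[x xt ->]; apply/prime_polyC/tP.
  by rewrite big_map {1}ef ev polyCM rmorph_prod.
have [[g [h [ef gU hU]]]|irr] := classic (exists g h : {poly R},
    [/\ f = g * h, g \isn't a GRing.unit & h \isn't a GRing.unit]); last first.
  exists 1, [:: f]; split; rewrite ?unitr1 ?big_seq1 ?mul1r // => p.
  rewrite inE => /eqP->; apply: irreducible_poly_prime => // g h ef.
  have [gU|gU] := boolP (g \is a GRing.unit); first by left.
  have [hU|hU] := boolP (h \is a GRing.unit); first by right.
  by case: irr; exists g, h.
have : (g != 0) && (h != 0) by rewrite -negb_or -mulf_eq0 -ef.
case/andP=> g0 h0.
have : \prod_(p <- s) p * u = lead_coef g * lead_coef h.
  by rewrite -lead_coefM -ef lf mulrC.
case/(split_prime_prod sP)=> s1 [s2 [q1 [d1 [sz [h1 h2] lg lh eu]]]].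
have : (q1 \is a GRing.unit) && (d1 \is a GRing.unit) by rewrite -unitrM -eu.
case/andP=> qU dU.
(* a non-unit contributes its degree or a prime of its leading coefficient *)
have pos (k : {poly R}) t w : k != 0 -> k \isn't a GRing.unit ->
    w \is a GRing.unit -> lead_coef k = \prod_(p <- t) p * w ->
    (1 < size t + size k)%N.
  move=> k0 kU wU lk; have := k0; rewrite -size_poly_gt0.
  case: (ltngtP (size k) 1%N) => [|k1 _|k1 _]; first by case: (size k).
    by rewrite ltn_addl.
  case: t lk => [|p t] lk; last by rewrite k1 addn1.
  move: kU; rewrite poly_unitE k1 eqxx /=.
  by move: lk; rewrite big_nil mul1r lead_coefE k1 /= => ->; rewrite wU.
have sgh := size_mul g0 h0; rewrite -ef in sgh.
have ph := pos _ _ _ h0 hU dU lh; have pg := pos _ _ _ g0 gU qU lg.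
have := size_poly_gt0 g; have := size_poly_gt0 h; rewrite g0 h0 => zh zg.
have sz' : (size s1 + size g + (size s2 + size h) = (size s + size f).+1)%N.
  by rewrite addnACA sz sgh -addnS prednK // addn_gt0 zg.
have [||v1 [t1 [v1U t1P e1]]] := IH g q1 s1 _ g0 qU (fun p ps => sP p (h1 p ps)).
- have: (size s1 + size g + 2 <= (size s + size f).+1)%N by rewrite -sz' leq_add2l.
  by rewrite addn2 => hh; apply: leq_trans hm.
- by rewrite mulrC.
have [||v2 [t2 [v2U t2P e2]]] := IH h d1 s2 _ h0 dU (fun p ps => sP p (h2 p ps)).
- have: (2 + (size s2 + size h) <= (size s + size f).+1)%N by rewrite -sz' leq_add2r.
  by rewrite add2n => hh; apply: leq_trans hm.
- by rewrite mulrC.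
exists (v1 * v2), (t1 ++ t2); split; first by rewrite unitrM v1U v2U.
  by move=> p; rewrite mem_cat => /orP[/t1P|/t2P].
by rewrite big_cat ef e1 e2 /= mulrACA.
Qed.

Lemma factorial_iso (S : idomainType) (f : {rmorphism S -> R})
    (g : {rmorphism R -> S}) :
  cancel f g -> cancel g f -> factorial S.
Proof.
move=> fK gK.
have U (x : R) : (g x \is a GRing.unit) = (x \is a GRing.unit).
  apply/idP/idP; last exact: rmorph_unit.
  by move/(rmorph_unit f); rewrite gK.
have D (x y : R) : dvdr (g x) (g y) -> dvdr x y.
  by case=> c e; exists (f c); apply: (can_inj gK); rewrite rmorphM /= fK.
have D' (x y : R) : dvdr x y -> dvdr (g x) (g y).
  by case=> c ->; exists (g c); rewrite rmorphM.
move=> a a0; have : f a != 0 by rewrite -(rmorph0 f) (can_eq fK).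
case/facR=> u [s [uU sP e]]; exists (g u), [seq g x | x <- s]; split.
- by rewrite U.
- move=> p /mapP[x /sP[x0 xU xP] ->]; split; rewrite ?U //.
    by rewrite -(rmorph0 g) (can_eq gK).
  move=> b c; rewrite -[b]fK -[c]fK -rmorphM => /D /xP[] h; [left|right];
  exact: D'.
- by rewrite big_map -rmorph_prod -rmorphM -e fK.
Qed.

End FactorialRings.

(** The inverse of [muni], as a ring morphism. *)
Definition of_muni (R : idomainType) n : {poly {mpoly R[n]}} -> {mpoly R[n.+1]} :=
  horner_eval ('X_ord_max : {mpoly R[n.+1]}) \o map_poly (@mwiden n R).

HB.instance Definition _ (R : idomainType) n :=
  GRing.RMorphism.on (@of_muni R n).

Lemma muni_mnmwiden (R : idomainType) n (c : {mpoly R[n]}) :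
  muni (mwiden c) = c%:P.
Proof.
rewrite [in RHS](mpolyE c) {1}(mpolyE c) (raddf_sum (@mwiden n R)).
rewrite (raddf_sum (@muni n R)) (raddf_sum polyC) /=; apply: eq_bigr => m _.
rewrite mwidenZ mwidenX muniZ muniE msuppX big_seq1 mcoeffX eqxx scale1r.
have -> : [multinom mnmwiden m (widen_ord (leqnSn n) i) | i < n] = m.
  by apply/mnmP=> i; rewrite mnmE mnmwiden_widen.
by rewrite mnmwiden_ordmax expr0 scalerA mul_mpolyC alg_polyC.
Qed.

Lemma muni_max (R : idomainType) n : muni ('X_ord_max : {mpoly R[n.+1]}) = 'X.
Proof.
rewrite muniE msuppX big_seq1 mcoeffX eqxx scale1r mnm1E eqxx expr1.
have -> : [multinom U_(ord_max)%MM (widen_ord (leqnSn n) i) | i < n] = 0%MM.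
  by apply/mnmP=> i; rewrite mnmE mnm1E mnm0E -val_eqE /= gtn_eqF.
by rewrite mpolyX0 scale1r.
Qed.

Lemma of_muniK (R : idomainType) n : cancel (@of_muni R n) (@muni n R).
Proof.
move=> p; rewrite /of_muni /= /horner_eval -{2}[p]coefK.
rewrite horner_coef (size_map_inj_poly (@inj_mwiden _ _)) ?mwiden0 //.
rewrite raddf_sum poly_def /=; apply: eq_bigr => i _.
rewrite coef_map_id0 ?mwiden0 // rmorphM rmorphXn /= muni_mnmwiden muni_max.
by rewrite mul_polyC.
Qed.

Lemma muniK (R : idomainType) n : cancel (@muni n R) (@of_muni R n).
Proof.
move=> p; rewrite {2}[p]mpolyE muniE raddf_sum; apply: eq_bigr => m _.
rewrite -mul_polyC /= rmorphM rmorphXn /= /of_muni /= map_polyC map_polyX.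
rewrite /horner_eval /= hornerC hornerX mwidenZ mwidenX -scalerAl.
rewrite mpolyXn -mpolyXD; congr (_ *: 'X_[_]); apply/mnmP=> i.
rewrite mnmDE mulmnE mnm1E; case: (unliftP ord_max i) => [j ->|->]; last first.
  by rewrite mnmwiden_ordmax eqxx mul1n.
have -> : lift ord_max j = widen_ord (leqnSn n) j.
  by apply/val_inj; rewrite /= /bump leqNgt ltn_ord.
rewrite mnmwiden_widen mnmE -val_eqE /= gtn_eqF ?mul0n ?addn0 //.
Qed.


Lemma factorial_mpoly (K : fieldType) n : factorial {mpoly K[n]}.
Proof.
elim: n => [|n IH]; last exact: (@factorial_iso _ (factorial_poly IH) {mpoly K[n.+1]} (@muni n K) (@of_muni K n) (@muniK _ _) (@of_muniK _ _)).
move=> a a0; exists a, [::]; split; rewrite ?big_nil ?mulr1 //.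
have ea := nvar0_mpolyC a; have c0 : a@_0%MM != 0.
  by apply: contra a0 => /eqP z; rewrite ea z.
by rewrite [_ \is a _](_ : _ = mpoly_unit a) // /mpoly_unit ea mcoeffC eqxx mulr1 eqxx unitfE.
Qed.

(** * Derivations and algebraic extensions *)

(** The last clause makes [D] a derivation of the subring [ev A] of [C], while
    its values are still computed on representatives in [A]. *)
Definition derivation_along (A C : comNzRingType) (ev : A -> C) (D : A -> C) :=
  [/\ {morph D : x y / x + y}, forall x y, D (x * y) = D x * ev y + ev x * D y
    & forall x, ev x = 0 -> D x = 0].

Lemma ex_min_classical (P : nat -> Prop) :
  (exists k, P k) -> exists k, P k /\ forall j, (j < k)%N -> ~ P j.
Proof.
case=> k; elim/ltn_ind: k => k IH Pk.
have [[j [jk Pj]]|no] := classic (exists j, (j < k)%N /\ P j).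
  exact: IH Pj.
by exists k; split=> // j jk Pj; apply: no; exists j.
Qed.

Section DerivationStep.
Variables (A : idomainType) (C : fieldType) (ev : {rmorphism A -> C}).
Variable D : A -> C.
Hypothesis derD : derivation_along ev D.
Variable a : C.

Let D0 : D 0 = 0. Proof. by have [_ _] := derD; apply; rewrite rmorph0. Qed.

Definition ev_at : {poly A} -> C := horner_eval a \o map_poly ev.

HB.instance Definition _ := GRing.RMorphism.on ev_at.

Lemma ev_atE p : ev_at p = (map_poly ev p).[a]. Proof. by []. Qed.

Lemma map_derD p q : map_poly D (p + q) = map_poly D p + map_poly D q.
Proof.
have [DD _ _] := derD.
by apply/polyP=> i; rewrite coefD !coef_map_id0 // coefD DD.
Qed.

Lemma map_derM p q : map_poly D (p * q) =
  map_poly D p * map_poly ev q + map_poly ev p * map_poly D q.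
Proof.
have [DD DM _] := derD.
have Dsum (I : Type) (r : seq I) (F : I -> A) :
    D (\sum_(i <- r) F i) = \sum_(i <- r) D (F i).
  exact: (big_morph D DD D0).
apply/polyP=> i; rewrite coefD coef_map_id0 // !coefM Dsum -big_split.
by apply: eq_bigr => j _; rewrite DM !coef_map_id0 ?rmorph0.
Qed.

Definition der_at (t y : C) p : C :=
  t * (map_poly D p).[a] + y * (map_poly ev p)^`().[a].

Lemma der_atD t y : {morph der_at t y : p q / p + q}.
Proof.
move=> p q; rewrite /der_at map_derD rmorphD /= derivD !hornerD !mulrDr.
by rewrite addrACA.
Qed.

Lemma der_atM t y p q :
  der_at t y (p * q) = der_at t y p * ev_at q + ev_at p * der_at t y q.
Proof.
rewrite /der_at map_derM rmorphM /= derivM !hornerD !hornerM !ev_atE.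
by rewrite !mulrDr !mulrDl; ring.
Qed.

Lemma der_atC t y c : der_at t y c%:P = t * D c.
Proof.
have -> : der_at t y c%:P = t * (map_poly D c%:P).[a].
  by rewrite /der_at map_polyC derivC hornerC mulr0 addr0.
rewrite (_ : map_poly D c%:P = (D c)%:P) ?hornerC //.
by apply/polyP=> i; rewrite coef_map_id0 // !coefC; case: eqP.
Qed.

(** Extending to one more algebraic element [a]: the relations between [a] and
    the image of [A] all follow from one relation [mu] of least degree, so
    that the pair [(t, y)] has to satisfy a single linear equation. When [a]
    is inseparable, the coefficient of [y] vanishes, and the old derivation may
    have to be given up for the one that only differentiates with respect
    to [a]. *)
Lemma der_at_exists (q : {poly A}) :
    map_poly ev q != 0 -> root (map_poly ev q) a ->
  exists t y, derivation_along ev_at (der_at t y)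
    /\ (t = 1 \/ t = 0 /\ y = 1).
Proof.
move=> q0 qa.
pose P k := exists mu : {poly A},
  [/\ size mu = k, map_poly ev mu != 0 & ev_at mu = 0].
have [|k [[mu [smu mu0 mua]] kmin]] := @ex_min_classical P.
  by exists (size q), q; split=> //; apply/eqP.
have min (r : {poly A}) : (size r < k)%N -> ev_at r = 0 -> map_poly ev r = 0.
  move=> hr r0; apply/eqP; case: eqP => // /eqP nz.
  by case: (kmin _ hr); exists r.
have muN0 : mu != 0 by apply: contraNneq mu0 => ->; rewrite rmorph0.
have lc : ev (lead_coef mu) != 0.
  apply/negP=> /eqP z; pose r := mu - lead_coef mu *: 'X^((size mu).-1).
  have er : map_poly ev r = map_poly ev mu.
    by rewrite /r rmorphB /= map_polyZ /= z scale0r subr0.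
  move: mu0; rewrite -er min ?eqxx //; last by rewrite ev_atE er.
  rewrite -smu -[X in (_ < X)%N](prednK (_ : 0 < size mu)%N) ?size_poly_gt0 // ltnS.
  apply/leq_sizeP=> j hj; rewrite coefB coefZ coefXn.
  case: (ltngtP j (size mu).-1) hj => // [hj _|-> _].
    by rewrite mulr0 subr0 nth_default // -(prednK (_ : 0 < size mu)%N) ?size_poly_gt0.
  by rewrite mulr1 subrr.
suff main t y : der_at t y mu = 0 -> derivation_along ev_at (der_at t y).
  pose al := (map_poly D mu).[a]; pose be := (map_poly ev mu)^`().[a].
  have [b0|b0] := eqVneq be 0; last first.
    exists 1, (- al / be); split; last by left.
    by apply: main; rewrite /der_at mul1r -/al -/be divfK // subrr.
  have [a0|a0] := eqVneq al 0.
    exists 1, 0; split; last by left.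
    by apply: main; rewrite /der_at mul1r -/al -/be a0 mul0r addr0.
  exists 0, 1; split; last by right.
  by apply: main; rewrite /der_at mul0r mul1r -/be b0 addr0.
move=> dmu; split; [exact: der_atD | exact: der_atM|].
move=> p pa; have e := Pdiv.ComRing.rdivp_eq mu p.
set c := lead_coef mu ^+ _ in e; set Q := Pdiv.Ring.rdivp p mu in e.
set r := Pdiv.Ring.rmodp p mu in e.
have c0 : ev c != 0 by rewrite rmorphXn /= expf_neq0.
have ra : ev_at r = 0.
  have -> : r = c *: p - Q * mu by rewrite e addrC addKr.
  by rewrite rmorphB rmorphM /= mua mulr0 subr0 -mul_polyC rmorphM /= pa mulr0.
have r0 : map_poly ev r = 0.
  by apply: min ra; rewrite -smu Pdiv.Ring.ltn_rmodpN0.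
have dr : der_at t y r = 0.
  rewrite /der_at r0 deriv0 horner0 mulr0 addr0.
  rewrite (_ : map_poly D r = 0) ?horner0 ?mulr0 //.
  apply/polyP=> i; rewrite coef_map_id0 // coef0.
  by have [_ _] := derD; apply; rewrite -coef_map r0 coef0.
have := congr1 (der_at t y) e.
rewrite der_atD dr addr0 der_atM dmu mua !mulr0 addr0.
rewrite -mul_polyC der_atM pa mulr0 add0r ev_atE map_polyC hornerC.
by move/eqP; rewrite mulf_eq0 (negPf c0) => /eqP.
Qed.

End DerivationStep.

(** A derivation need not extend to an inseparable extension, but there is
    always a nonzero derivation whose restriction is a multiple, by [del], of
    the given one. By induction, adjoining the elements of [s] one at a time
    with [der_at_exists]: when a step gives up the old derivation, [del]
    becomes [0] and the new one is nonzero on the element adjoined. *)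
Lemma derivation_extension (A0 : idomainType) (C : fieldType)
    (ev0 : {rmorphism A0 -> C}) (D0 : A0 -> C) (s : seq C) :
    derivation_along ev0 D0 ->
    (forall a, a \in s -> exists q : {poly A0},
       map_poly ev0 q != 0 /\ root (map_poly ev0 q) a) ->
  exists (A : idomainType) (ev : {rmorphism A -> C}) (io : {rmorphism A0 -> A})
      (lift : C -> A) (D : A -> C) (del : C),
    [/\ forall x, ev (io x) = ev0 x, {in s, cancel lift ev},
        derivation_along ev D, forall x, D (io x) = del * D0 x
      & del != 0 \/ exists2 x, ev x \in s & D x != 0].
Proof.
move=> der0; elim: s => [|a s IH] alg.
  exists A0, ev0, (idfun : {rmorphism A0 -> A0}), (fun=> 0), D0, 1.
  by split=> // [x|]; rewrite ?mul1r //; left; rewrite oner_eq0.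
have [|A [ev [io [lift [D [del [hev hlift derD hdel nz]]]]]]] := IH.
  by move=> b bs; apply: alg; rewrite inE bs orbT.
have [q [q0 qa]] : exists q : {poly A}, map_poly ev q != 0 /\ root (map_poly ev q) a.
  have [|q [q0 qa]] := alg a; first by rewrite inE eqxx.
  exists (map_poly io q).
  rewrite (_ : map_poly ev _ = map_poly ev0 q) //.
  by rewrite -map_poly_comp; apply: eq_map_poly => x /=.
have [t [y [der' ty]]] := der_at_exists derD q0 qa.
exists {poly A}, (ev_at ev a : {rmorphism {poly A} -> C}),
  (polyC \o io : {rmorphism A0 -> {poly A}}),
  (fun c => if c == a then 'X else (lift c)%:P), (der_at ev D a t y), (t * del).
split=> //.
- by move=> x /=; rewrite ev_atE map_polyC hornerC /= hev.
- move=> b; rewrite inE /=; case: eqP => [-> _|_ /= bs].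
    by rewrite ev_atE map_polyX hornerX.
  by rewrite ev_atE map_polyC hornerC; apply: hlift.
- by move=> x /=; rewrite der_atC // hdel mulrA.
case: ty => [t1|[t0 y1]].
  case: nz => [d0|[x xs xD]]; first by left; rewrite t1 mul1r.
  right; exists x%:P; rewrite /= ?ev_atE ?map_polyC ?hornerC ?inE ?xs ?orbT //.
  by rewrite der_atC // t1 mul1r.
right; exists 'X; first by rewrite /= ev_atE map_polyX hornerX inE eqxx.
by rewrite /der_at t0 y1 mul0r add0r mul1r map_polyX derivX hornerC oner_eq0.
Qed.

Lemma fraction_numden (R : idomainType) (x : {fraction R}) :
  exists n d : R, d != 0 /\ tofrac d * x = tofrac n.
Proof.
elim/quotW: x => r; exists \n_r, \d_r; split; first exact: denom_ratioP.
apply/eqP; rewrite -[_ * _]/(FracField.mul _ _) !piE FracField.equivfE.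
rewrite /FracField.mulf !numden_Ratio ?oner_eq0 ?mulf_neq0 ?oner_eq0 ?denom_ratioP //.
by rewrite mulr1 mul1r.
Qed.

Lemma clear_denominators (R : idomainType) (p : {poly {fraction R}}) :
  exists (d : R) (q : {poly R}), d != 0 /\ tofrac d *: p = map_poly (@tofrac R) q.
Proof.
elim/poly_ind: p => [|p c [d [q [d0 e]]]].
  by exists 1, 0; rewrite oner_eq0 scaler0 rmorph0.
have [n [b [b0 eb]]] := fraction_numden c.
exists (d * b), (b *: q * 'X + (d * n)%:P); split; first by rewrite mulf_neq0.
rewrite [RHS]rmorphD [in RHS]rmorphM /= map_polyZ map_polyC map_polyX /= -e.
rewrite !rmorphM /= -eb.
rewrite scalerDr; congr (_ + _); first by rewrite mulrC -scalerA -!scalerAl.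
by rewrite -mul_polyC -!polyCM mulrA.
Qed.

(** [derivation_extension] without the auxiliary ring, for use on coefficients
    in [C]: the derivation is a function [d] that is meaningful on a subring
    [X] only. *)
Lemma partial_derivation (A0 : idomainType) (C : fieldType)
    (ev0 : {rmorphism A0 -> C}) (D0 : A0 -> C) (s : seq C) :
    derivation_along ev0 D0 ->
    (forall a, a \in s -> exists q : {poly A0},
       map_poly ev0 q != 0 /\ root (map_poly ev0 q) a) ->
  exists (X : C -> Prop) (d : C -> C) (del : C),
    [/\ [/\ forall x, X (ev0 x), forall a, a \in s -> X a,
            forall x y, X x -> X y -> X (x + y)
          & forall x y, X x -> X y -> X (x * y)],
        forall x y, X x -> X y -> d (x + y) = d x + d y,
        forall x y, X x -> X y -> d (x * y) = d x * y + x * d y,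
        forall x, d (ev0 x) = del * D0 x
      & del != 0 \/ exists2 a, a \in s & d a != 0].
Proof.
move=> der0 alg.
have [A [ev [io [lift [D [del [hev hlift derD hdel nz]]]]]]] :=
  derivation_extension der0 alg.
have [DD DM Dker] := derD.
have D00 : D 0 = 0 by apply: Dker; rewrite rmorph0.
have DN x : D (- x) = - D x.
  by apply/eqP; rewrite -addr_eq0 -DD addNr D00.
have Deq x y : ev x = ev y -> D x = D y.
  move=> e; apply/eqP; rewrite -subr_eq0 -DN -DD; apply/eqP/Dker.
  by rewrite rmorphB /= e subrr.
pose d c := epsilon (inhabits 0) (fun y => exists x, ev x = c /\ y = D x).
have dE x : d (ev x) = D x.
  have := epsilon_spec (inhabits 0) (fun y => exists z, ev z = ev x /\ y = D z).
  by case=> [|z [/Deq <- //]]; exists (D x), x.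
exists (fun c => exists x, ev x = c), d, del; split.
- split=> [x|a /hlift e|x y [x' <-] [y' <-]|x y [x' <-] [y' <-]].
  + by exists (io x).
  + by exists (lift a).
  + by exists (x' + y'); rewrite rmorphD.
  + by exists (x' * y'); rewrite rmorphM.
- by move=> _ _ [x <-] [y <-]; rewrite -rmorphD !dE DD.
- by move=> _ _ [x <-] [y <-]; rewrite -rmorphM !dE DM.
- by move=> x; rewrite -hev dE hdel.
- case: nz => [|[x xs xD]]; first by left.
  by right; exists (ev x); rewrite ?dE.
Qed.

Section PartialDerivationMpoly.
Variables (C : idomainType) (n : nat) (X : C -> Prop) (d : C -> C).
Hypotheses (X0 : X 0) (XD : forall x y, X x -> X y -> X (x + y)).
Hypothesis XM : forall x y, X x -> X y -> X (x * y).
Hypothesis dD : forall x y, X x -> X y -> d (x + y) = d x + d y.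
Hypothesis dM : forall x y, X x -> X y -> d (x * y) = d x * y + x * d y.
Implicit Types p q : {mpoly C[n]}.

Definition mcoeffs_in p := forall m, X p@_m.

Definition dmap p : {mpoly C[n]} := \sum_(m <- msupp p) d p@_m *: 'X_[m].

Let d0 : d 0 = 0.
Proof. by apply: (addrI (d 0)); rewrite -dD // !addr0. Qed.

Lemma mcoeff_dmap p m : (dmap p)@_m = d p@_m.
Proof.
rewrite /dmap raddf_sum /=; have [mp|mp] := boolP (m \in msupp p).
  rewrite (bigD1_seq m) ?msupp_uniq //= mcoeffZ mcoeffX eqxx mulr1.
  rewrite big1 ?addr0 // => k km.
  by rewrite mcoeffZ mcoeffX (negPf km) mulr0.
rewrite (memN_msupp_eq0 mp) d0 big_seq big1 // => k kp.
rewrite mcoeffZ mcoeffX; case: eqP => [e|]; last by rewrite mulr0.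
by rewrite -e kp in mp.
Qed.

Lemma msupp_dmap p : {subset msupp (dmap p) <= msupp p}.
Proof.
move=> m; rewrite !mcoeff_msupp mcoeff_dmap; apply: contraNneq => ->.
by rewrite d0.
Qed.

Lemma mcoeffs_sum (I : Type) (r : seq I) (P : pred I) (F : I -> C) :
  (forall i, X (F i)) ->
  X (\sum_(i <- r | P i) F i) /\
  d (\sum_(i <- r | P i) F i) = \sum_(i <- r | P i) d (F i).
Proof.
move=> h; elim/big_rec2: _ => [|i y x _ [h1 h2]]; first by split.
by split; [apply: XD | rewrite dD // h2].
Qed.

Lemma mcoeffs_inM p q : mcoeffs_in p -> mcoeffs_in q -> mcoeffs_in (p * q).
Proof.
move=> hp hq m; rewrite mcoeffM.
by apply: (proj1 (mcoeffs_sum _ _ _)) => k; apply: XM.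
Qed.

Lemma dmapM p q : mcoeffs_in p -> mcoeffs_in q ->
  dmap (p * q) = dmap p * q + p * dmap q.
Proof.
move=> hp hq; apply/mpolyP=> m; rewrite mcoeffD mcoeff_dmap !mcoeffM.
rewrite (proj2 (mcoeffs_sum _ _ _)); last by move=> k; apply: XM.
rewrite -big_split; apply: eq_bigr => k _.
by rewrite dM // !mcoeff_dmap.
Qed.

End PartialDerivationMpoly.

(** * The generic sum and its derivations *)

Section GenericSum.
Variables (K : fieldType) (n l : nat) (C : closedFieldType).
Variable iota : {rmorphism {fraction {mpoly K[l]}} -> C}.

HB.instance Definition _ := GRing.RMorphism.copy (base_emb iota)
  (iota \o @tofrac {mpoly K[l]} \o @mpolyC l K).

HB.instance Definition _ := GRing.RMorphism.copy (@ext_poly K n l C iota)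
  (map_mpoly (base_emb iota)).

Lemma mcoeff_ext p m : (ext_poly (n := n) iota p)@_m = base_emb iota p@_m.
Proof. exact: mcoeff_map_mpoly. Qed.

Lemma ext_polyX m : ext_poly (n := n) iota 'X_[m] = 'X_[m].
Proof. exact: map_mpolyX. Qed.

Lemma ext_polyZ c p : ext_poly (n := n) iota (c *: p) = base_emb iota c *: ext_poly iota p.
Proof. by rewrite -!mul_mpolyC rmorphM /= /ext_poly map_mpolyC. Qed.

Variables (P : {mpoly K[n]}) (Q : 'I_l -> {mpoly K[n]}).

Lemma mcoeff_generic_sum m : (generic_sum iota P Q)@_m =
  iota (tofrac ((P@_m)%:MP + \sum_(j < l) 'X_j * ((Q j)@_m)%:MP)).
Proof.
rewrite mcoeffD mcoeff_ext raddf_sum /= !rmorphD !rmorph_sum /=; congr (_ + _).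
by apply: eq_bigr => j _; rewrite mcoeffZ mcoeff_ext !rmorphM.
Qed.

Hypothesis hC : is_algebraic_closure iota.

(** The derivation with respect to the [i]-th indeterminate is defined on the
    polynomials in the indeterminates; [partial_derivation] provides a multiple
    of it on a ring containing [s]. The generic sum is affine in the
    indeterminates, and [Q i] is the coefficient of the [i]-th. *)
Lemma generic_derivation (i : 'I_l) (s : seq C) :
  exists (X : C -> Prop) (d : C -> C) (del : C),
    [/\ [/\ X 0, forall a, a \in s -> X a,
            forall x y, X x -> X y -> X (x + y)
          & forall x y, X x -> X y -> X (x * y)],
        forall x y, X x -> X y -> d (x + y) = d x + d y,
        forall x y, X x -> X y -> d (x * y) = d x * y + x * d y,
        d 1 = 0 /\ dmap d (generic_sum iota P Q) = del *: ext_poly iota (Q i)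
      & del != 0 \/ exists2 a, a \in s & d a != 0].
Proof.
pose ev0 : {rmorphism {mpoly K[l]} -> C} := (iota \o @tofrac {mpoly K[l]}).
have inj0 x : ev0 x = 0 -> x = 0.
  by move/eqP; rewrite /= fmorph_eq0 tofrac_eq0 => /eqP.
have der0 : derivation_along ev0 (fun x => ev0 (x^`M(i))).
  split=> [x y|x y|x /inj0->]; first by rewrite mderivD rmorphD.
    by rewrite mderivM rmorphD !rmorphM.
  by rewrite mderiv0 rmorph0.
have alg a : a \in s -> exists q : {poly {mpoly K[l]}},
    map_poly ev0 q != 0 /\ root (map_poly ev0 q) a.
  move=> _; have [p p0 pa] := hC a; have [b [q [b0 e]]] := clear_denominators p.
  exists q; have -> : map_poly ev0 q = iota (tofrac b) *: map_poly iota p.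
    by rewrite -map_polyZ /= e -map_poly_comp.
  have z : iota (tofrac b) != 0 by rewrite fmorph_eq0 tofrac_eq0.
  by rewrite rootZ // scaler_eq0 negb_or z map_poly_eq0.
have [X [d [del [[Xe Xs XD XM] dD dM de nz]]]] := partial_derivation der0 alg.
have X0 : X 0 by rewrite -(rmorph0 ev0).
exists X, d, del; split=> //; split.
  by rewrite -(rmorph1 ev0) de -[1]/(1%:MP) mderivC rmorph0 mulr0.
apply/mpolyP=> m; rewrite (mcoeff_dmap X0 dD) mcoeffZ mcoeff_ext.
rewrite mcoeff_generic_sum (de _) mderivD mderivC add0r (raddf_sum (mderiv i)) /=.
rewrite (bigD1 i) //= big1 ?addr0 => [|j ji].
  by rewrite mderivM mderivC mulr0 addr0 mderivX mnm1E eqxx scale1r -{1}[U_(i)%MM]add0m addmK mpolyX0 mul1r.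
by rewrite mderivM mderivC mulr0 addr0 mderivX mnm1E (negPf ji) scale0r mul0r.
Qed.

End GenericSum.

(** * Differentiating a factorization *)

Section GenericFactorization.
Variables (K : fieldType) (n l : nat) (C : closedFieldType).
Variable iota : {rmorphism {fraction {mpoly K[l]}} -> C}.
Hypothesis hC : is_algebraic_closure iota.
Variables (P : {mpoly K[n]}) (Q : 'I_l -> {mpoly K[n]}).
Let F := generic_sum iota P Q.

(** Differentiate [F = Phi * G] with a derivation which is nonzero on some
    coefficient of [Phi] or [G]. If [del] were [0], coprimality would force the
    derivatives of both factors to vanish, the normalization of [Phi]
    excluding multiples of [Phi]. So [del] is not [0], although the
    coefficients might have been inseparable over the rational functions. *)
Lemma coprime_factorization_derivative (Phi G : {mpoly C[n]}) (m0 : 'X_{1..n}) (i : 'I_l) :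
    F = Phi * G -> G != 0 -> Phi@_m0 = 1 ->
    (forall u v, u * G + Phi * v = 0 -> {subset msupp u <= msupp Phi} ->
       exists c, u = c *: Phi) ->
  exists u v, [/\ {subset msupp u <= msupp Phi}, {subset msupp v <= msupp G}
    & ext_poly iota (Q i) = u * G + Phi * v].
Proof.
move=> eF G0 Phi1 cop.
pose s := [seq Phi@_m | m <- msupp Phi] ++ [seq G@_m | m <- msupp G].
have [X [d [del [[X0 Xs XD XM] dD dM [d1 dF] nz]]]] :=
  generic_derivation P Q hC i s.
have XPhi : mcoeffs_in X Phi.
  move=> m; have [mP|/memN_msupp_eq0->//] := boolP (m \in msupp Phi).
  by apply: Xs; rewrite mem_cat (map_f (fun k => Phi@_k) mP).
have XG : mcoeffs_in X G.
  move=> m; have [mG|/memN_msupp_eq0->//] := boolP (m \in msupp G).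
  by apply: Xs; rewrite mem_cat orbC (map_f (fun k => G@_k) mG).
have e : del *: ext_poly iota (Q i) = dmap d Phi * G + Phi * dmap d G.
  by rewrite -dF -/F eF (dmapM X0 XD XM dD dM).
have sP := msupp_dmap (p := Phi) X0 dD; have sG := msupp_dmap (p := G) X0 dD.
have [del0|del0] := eqVneq del 0; last first.
  exists (del^-1 *: dmap d Phi), (del^-1 *: dmap d G); split.
  - by move=> m /msuppZ_le /sP.
  - by move=> m /msuppZ_le /sG.
  - by rewrite -scalerAl -scalerAr -scalerDr -e scalerA mulVf // scale1r.
(* a derivation that kills every coefficient of [F] kills those of its factors *)
move: e; rewrite del0 scale0r => /esym e; have [c ec] := cop _ _ e sP.
have dP0 : dmap d Phi = 0.
  have := congr1 (mcoeff m0) ec.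
  rewrite (mcoeff_dmap X0 dD) mcoeffZ Phi1 d1 mulr1 => c0.
  by rewrite ec -c0 scale0r.
have Phi0 : Phi != 0 by apply: contraTneq isT => z; move: Phi1; rewrite z mcoeff0 => /eqP; rewrite eq_sym oner_eq0.
have dG0 : dmap d G = 0.
  by move/eqP: e; rewrite dP0 mul0r add0r mulf_eq0 (negPf Phi0) => /eqP.
case: nz; first by rewrite del0 eqxx.
case=> a; rewrite mem_cat => /orP[]/mapP[m _ ->].
  by rewrite -(mcoeff_dmap X0 dD) dP0 mcoeff0 eqxx.
by rewrite -(mcoeff_dmap X0 dD) dG0 mcoeff0 eqxx.
Qed.

(** The same argument for [F = f ^+ e.+1], whose derivative is
    [e.+1 f ^+ e] times that of [f]. *)
Lemma power_derivative (f : {mpoly C[n]}) e (i : 'I_l) :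
    F = f ^+ e.+1 -> f != 0 -> e.+1%:R != 0 :> C ->
  exists u, ext_poly iota (Q i) = f ^+ e * u.
Proof.
move=> eF f0 e0; pose s := [seq f@_m | m <- msupp f].
have [X [d [del [[X0 Xs XD XM] dD dM [d1 dF] nz]]]] :=
  generic_derivation P Q hC i s.
have Xf : mcoeffs_in X f.
  move=> m; have [mf|/memN_msupp_eq0->//] := boolP (m \in msupp f).
  by apply: Xs; apply: (map_f (fun k => f@_k) mf).
have pow k : mcoeffs_in X (f ^+ k.+1) /\
    dmap d (f ^+ k.+1) = k.+1%:R *: (f ^+ k * dmap d f).
  elim: k => [|k [h1 h2]]; first by rewrite expr1 expr0 mul1r scale1r; split.
  rewrite exprS; split; first exact: (mcoeffs_inM X0 XD XM dD).
  rewrite (dmapM X0 XD XM dD dM) // h2 -scalerAr mulrA -exprS.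
  by rewrite [dmap d f * _]mulrC -{1}[f ^+ k.+1 * _]scale1r -scalerDl -mulrS.
have ee : del *: ext_poly iota (Q i) = e.+1%:R *: (f ^+ e * dmap d f).
  by rewrite -dF -/F eF (pow e).2.
have [del0|del0] := eqVneq del 0; last first.
  exists (del^-1 *: (e.+1%:R *: dmap d f)).
  by rewrite -!scalerAr -ee scalerA mulVf // scale1r.
have df0 : dmap d f = 0.
  move/esym/eqP: ee; rewrite del0 scale0r scaler_eq0 (negPf e0) /=.
  by rewrite mulf_eq0 expf_eq0 (negPf f0) andbF => /eqP.
case: nz; first by rewrite del0 eqxx.
case=> a /mapP[m _ ->].
by rewrite -(mcoeff_dmap X0 dD) df0 mcoeff0 eqxx.
Qed.

(** For [P], subtract from [F = Phi * G] the expressions of the [Q i]. *)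
Lemma coprime_factorization_monomials (Phi G : {mpoly C[n]}) (m0 : 'X_{1..n}) :
    F = Phi * G -> G != 0 -> Phi@_m0 = 1 ->
    (forall u v, u * G + Phi * v = 0 -> {subset msupp u <= msupp Phi} ->
       exists c, u = c *: Phi) ->
  forall R, R \in P :: codom Q ->
  exists u v, [/\ {subset msupp u <= msupp Phi}, {subset msupp v <= msupp G}
    & ext_poly iota R = u * G + Phi * v].
Proof.
move=> eF G0 Phi1 cop R.
have hQ i := coprime_factorization_derivative i eF G0 Phi1 cop.
rewrite inE => /predU1P[->|/codomP[i ->]]; last exact: hQ.
have [u /fin_all_exists[v huv]] := fin_all_exists hQ.
have su (w : 'I_l -> {mpoly C[n]}) (p : {mpoly C[n]}) :
    (forall i, {subset msupp (w i) <= msupp p}) ->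
    {subset msupp (\sum_i lam iota i *: w i) <= msupp p}.
  move=> h; elim/big_ind: _ => [m|a b ha hb m|i _ m]; first by rewrite msupp0.
    by move/msuppD_le; rewrite mem_cat => /orP[/ha|/hb].
  by move/msuppZ_le/h.
exists (- \sum_i lam iota i *: u i), (G - \sum_i lam iota i *: v i); split.
- move=> m; rewrite (perm_mem (msuppN _)); apply: su => i.
  by have [] := huv i.
- move=> m /msuppB_le; rewrite mem_cat => /orP[//|]; apply: su => i.
  by have [] := huv i.
rewrite mulNr mulrBr -eF /F /generic_sum addrCA -opprD.
rewrite -[LHS]addr0 -addrA; congr (_ + _); rewrite mulr_suml mulr_sumr -big_split.
apply/esym/eqP; rewrite subr_eq0; apply/eqP; apply: eq_bigr => i _.
by have [_ _ ->] := huv i; rewrite scalerDr scalerAl scalerAr.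
Qed.

End GenericFactorization.

(** * Binary forms *)

Section BinaryForms.
Variables (k : closedFieldType) (n : nat).
Implicit Types (u v : {mpoly k[n]}).

Definition form_value (d : nat) (a : nat -> k) u v : {mpoly k[n]} :=
  \sum_(j < d.+1) a j *: (u ^+ j * v ^+ (d - j)).

Definition linear_value (l : k * k) u v : {mpoly k[n]} := l.1 *: u + l.2 *: v.

(** Multiplying a form by [u - z v] amounts to multiplying its dehomogenization
    by ['X - z]; the conditional expressions are the shifted coefficients. *)
Lemma form_valueS d a z u v :
  form_value d.+1 (fun j => (if j is j'.+1 then a j' else 0) - z * (if (j <= d)%N then a j else 0)) u v
  = (u - z *: v) * form_value d a u v.
Proof.
rewrite /form_value mulrBl mulr_sumr -scalerAl mulr_sumr scaler_sumr.
under eq_bigr do rewrite scalerBl.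
rewrite big_split /= sumrN; congr (_ - _).
  rewrite big_ord_recl scale0r add0r; apply: eq_bigr => j _ /=.
  by rewrite subSS -scalerAr exprS mulrA.
rewrite big_ord_recr /= ltnn mulr0 scale0r addr0; apply: eq_bigr => j _.
rewrite -ltnS ltn_ord -scalerA -scalerAr; congr (_ *: (_ *: _)).
by rewrite subSn ?leq_ord // exprS mulrCA.
Qed.

(** A binary form over an algebraically closed field is a product of linear
    forms: factor the polynomial obtained by setting [v = 1], and supply a
    factor [v] for every degree missing. *)
Lemma form_split (d : nat) (a : nat -> k) : (exists2 j, (j <= d)%N & a j != 0) ->
  exists (c : k) (s : seq (k * k)),
    [/\ c != 0, size s = d, forall l, l \in s -> l != (0, 0)
      & forall u v, form_value d a u v = c *: \prod_(l <- s) linear_value l u v].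
Proof.
case=> j0 jd aj0; pose p := \poly_(j < d.+1) a j.
have pE j : (j <= d)%N -> p`_j = a j by move=> h; rewrite coef_poly ltnS h.
have p0 : p != 0 by apply: contra aj0 => /eqP z; rewrite -pE // z coef0.
have [r ep] := closed_field_poly_normal p.
have sr : (size r <= d)%N.
  have : (size p <= d.+1)%N := size_poly _ _.
  by rewrite ep size_scale ?lead_coef_eq0 // size_prod_XsubC ltnS.
exists (lead_coef p), ([seq (1, - z) | z <- r] ++ nseq (d - size r) (0, 1)).
split; first by rewrite lead_coef_eq0.
- by rewrite size_cat size_map size_nseq subnKC.
- move=> l; rewrite mem_cat => /orP[/mapP[z _ ->]|/nseqP[-> _]];
  by rewrite xpair_eqE oner_eq0 ?andbF.
move=> u v; rewrite big_cat /= big_map.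
have -> : \prod_(l <- nseq (d - size r) (0, 1)) linear_value l u v = v ^+ (d - size r).
  by rewrite big_nseq /linear_value /= scale0r scale1r add0r iter_mulr_1.
have -> : form_value d a u v = form_value d (fun j => p`_j) u v.
  by apply: eq_bigr => j _; rewrite pE // -ltnS.
rewrite {1}ep; move: (lead_coef p) => c {p0 pE p ep}.
elim: r d sr {j0 jd aj0 a} => [|z r IH] d sr.
  rewrite !big_nil mul1r subn0 /form_value big_ord_recl expr0 mul1r subn0.
  rewrite coefZ coef1 mulr1 big1 ?addr0 // => j _.
  by rewrite coefZ coef1 /= mulr0 scale0r.
case: d sr => // d sr; rewrite !big_cons (_ : d.+1 - size (z :: r) = d - size r)%N //.
transitivity (linear_value (1, - z) u v *
    form_value d (fun j => (c *: \prod_(z0 <- r) ('X - z0%:P))`_j) u v); last first.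
  by rewrite IH // -scalerAr mulrA.
rewrite /linear_value /= scale1r scaleNr -form_valueS.
apply: eq_bigr => j _; congr (_ *: _).
rewrite scalerAr; set q := _ *: _; rewrite mulrBl coefB coefXM coefCM.
have -> : (if (j <= d)%N then q`_j else 0) = q`_j.
  case: leqP => // lt; rewrite nth_default // /q.
  apply: leq_trans (size_scale_leq _ _) _; rewrite size_prod_XsubC.
  exact: leq_ltn_trans (sr : (size r <= d)%N) lt.
by case: (nat_of_ord j).
Qed.

Lemma form_value_add d a b u v :
  form_value d a u v + form_value d b u v = form_value d (fun j => a j + b j) u v.
Proof. by rewrite -big_split; apply: eq_bigr => j _; rewrite scalerDl. Qed.

Lemma form_value_mono d i c u v : (i <= d)%N ->
  c *: (u ^+ i * v ^+ (d - i)) = form_value d (fun j => if j == i then c else 0) u v.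
Proof.
move=> id; rewrite /form_value (bigD1 (Ordinal (id : i < d.+1)%N)) //= eqxx.
rewrite big1 ?addr0 // => j ji; rewrite ifF ?scale0r //.
by apply: contraNF ji => /eqP e; apply/eqP/val_inj.
Qed.

Lemma form_value_sum (I : eqType) (r : seq I) (F : I -> {mpoly k[n]}) d u v :
    (forall i, i \in r -> exists a, F i = form_value d a u v) ->
  exists a, \sum_(i <- r) F i = form_value d a u v.
Proof.
move=> h; rewrite big_seq; elim/big_ind: _ => [|x y [a ->] [b ->]|i]; last exact: h.
  by exists (fun=> 0); rewrite /form_value big1 // => j _; rewrite scale0r.
by rewrite form_value_add; eexists.
Qed.

End BinaryForms.

(** * Linear independence of the indeterminates *)

Section LinearIndependence.
Variables (K : fieldType) (n l : nat) (C : closedFieldType).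
Variable iota : {rmorphism {fraction {mpoly K[l]}} -> C}.

Lemma affine_eq0 (x : K) (y : 'I_l -> K) :
  (x%:MP + \sum_(j < l) 'X_j * (y j)%:MP == 0 :> {mpoly K[l]}) ->
  x = 0 /\ forall j, y j = 0.
Proof.
move/eqP=> e; have co m : x * (m == 0%MM)%:R + \sum_(j < l) y j * (U_(j)%MM == m)%:R = 0.
  have := congr1 (mcoeff m) e; rewrite mcoeff0 mcoeffD mcoeffC raddf_sum /=.
  move=> e'; rewrite -[RHS]e'; congr (_ + _); apply: eq_bigr => j _.
  by rewrite ['X_j * _]mulrC mcoeffCM mcoeffX.
split=> [|j].
  have := co 0%MM; rewrite eqxx mulr1 big1 ?addr0 // => j _.
  by rewrite mnm1_eq0 mulr0.
have := co U_(j)%MM; rewrite mnm1_eq0 mulr0 add0r (bigD1 j) //= eqxx mulr1.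
rewrite big1 ?addr0 // => i ij.
by rewrite eq_mnm1 (negPf ij) mulr0.
Qed.

Lemma lambda_independent (x : K) (y : 'I_l -> K) :
  base_emb iota x + \sum_j lam iota j * base_emb iota (y j) = 0 ->
  x = 0 /\ forall j, y j = 0.
Proof.
move=> e; apply: affine_eq0; rewrite -tofrac_eq0 -(fmorph_eq0 iota).
rewrite !rmorphD !rmorph_sum /=; apply/eqP; rewrite -[RHS]e; congr (_ + _).
by apply: eq_bigr => j _; rewrite !rmorphM.
Qed.

Variables (P : {mpoly K[n]}) (Q : 'I_l -> {mpoly K[n]}).
Let F := generic_sum iota P Q.

Lemma mcoeff_generic_sumE m : F@_m =
  base_emb iota P@_m + \sum_j lam iota j * base_emb iota (Q j)@_m.
Proof.
rewrite mcoeffD mcoeff_ext raddf_sum /=; congr (_ + _); apply: eq_bigr => j _.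
by rewrite mcoeffZ mcoeff_ext.
Qed.

Lemma msupp_generic_sum m :
  m \in msupp F <-> exists2 R, R \in P :: codom Q & m \in msupp R.
Proof.
split.
  move=> mF; have [mP|mP] := boolP (m \in msupp P).
    by exists P; rewrite ?inE ?eqxx.
  have [[j mj]|no] := classic (exists j, m \in msupp (Q j)).
    by exists (Q j) => //; rewrite inE codom_f orbT.
  move: mF; rewrite mcoeff_msupp mcoeff_generic_sumE.
  rewrite (memN_msupp_eq0 mP) rmorph0 add0r big1 ?eqxx // => j _.
  rewrite memN_msupp_eq0 ?rmorph0 ?mulr0 //.
  by apply/negP=> mj; apply: no; exists j.
case=> R RPQ mR; rewrite mcoeff_msupp mcoeff_generic_sumE.
apply/negP=> /eqP /lambda_independent [x0 y0].
move: RPQ mR; rewrite mcoeff_msupp inE => /predU1P[->|/codomP[j ->]].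
  by rewrite x0 eqxx.
by rewrite y0 eqxx.
Qed.

(** As [1] and the [lambda]s are independent over [K], a linear system over [K]
    solved by the generic sum is solved by each of its terms. *)
Lemma generic_sum_span N (w : 'I_N -> {mpoly K[n]}) (h : 'I_N -> C) :
    F = \sum_j h j *: ext_poly iota (w j) ->
  forall R, R \in P :: codom Q -> exists c : 'I_N -> K, R = \sum_j c j *: w j.
Proof.
move=> eF.
pose b := (msize P + \sum_i msize (Q i) + \sum_j msize (w j))%N.
pose mon (k : 'I_#|{: 'X_{1..n < b}}|) : 'X_{1..n} := (enum_val k : 'X_{1..n < b}).
pose rv (p : {mpoly K[n]}) := \row_k p@_(mon k).
pose W : 'M[K]_(N, _) := \matrix_j rv (w j).
have inspan R : (msize R <= b)%N -> rv R *m cokermx W = 0 ->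
    exists c : 'I_N -> K, R = \sum_j c j *: w j.
  move=> hR /eqP; rewrite -submxE => /submxP[c ec]; exists (fun j => c 0 j).
  apply/mpolyP=> m; rewrite raddf_sum /=.
  have [mb|mb] := leqP b (mdeg m).
    rewrite memN_msupp_eq0; last by rewrite msize_mdeg_ge // (leq_trans hR).
    rewrite big1 // => j _; rewrite mcoeffZ memN_msupp_eq0 ?mulr0 //.
    apply: msize_mdeg_ge; apply: leq_trans mb; rewrite /b (bigD1 j) //=.
    by rewrite addnCA leq_addr.
  have /rowP/(_ (enum_rank (BMultinom mb))) := ec.
  rewrite !mxE /mon enum_rankK /= => ->; apply: eq_bigr => j _.
  by rewrite !mxE /mon enum_rankK mcoeffZ.
(* multiply the coefficient vectors by a matrix whose kernel is the span of [w] *)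
have key : map_mx (base_emb iota) (rv P *m cokermx W) +
    \sum_i lam iota i *: map_mx (base_emb iota) (rv (Q i) *m cokermx W) = 0.
  transitivity ((\row_k F@_(mon k)) *m map_mx (base_emb iota) (cokermx W)).
    rewrite map_mxM; under eq_bigr do rewrite map_mxM scalemxAl.
    rewrite -mulmx_suml -mulmxDl; congr (_ *m _); apply/rowP=> k.
    rewrite !mxE summxE mcoeff_generic_sumE; congr (_ + _).
    by apply: eq_bigr => i _; rewrite !mxE.
  have -> : \row_k F@_(mon k) =
      (\row_j h j) *m map_mx (base_emb iota) W.
    apply/rowP=> k; rewrite !mxE eF raddf_sum; apply: eq_bigr => j _.
    by rewrite !mxE /= mcoeffZ mcoeff_ext.
  by rewrite -mulmxA -map_mxM mulmx_coker map_mx0 mulmx0.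
have key2 k : (rv P *m cokermx W) 0 k = 0 /\ forall i, (rv (Q i) *m cokermx W) 0 k = 0.
  apply: lambda_independent; have := congr1 (fun A : 'rV_ _ => A 0 k) key.
  rewrite /= !mxE summxE => e; rewrite -[RHS]e; congr (_ + _); apply: eq_bigr => i _.
  by rewrite !mxE.
move=> R; rewrite inE => /predU1P[->|/codomP[i ->]]; apply: inspan.
- by rewrite /b -addnA leq_addr.
- by apply/rowP=> k; rewrite (key2 k).1 mxE.
- by rewrite /b (bigD1 i) //= addnAC addnCA leq_addr.
- by apply/rowP=> k; rewrite (key2 k).2 mxE.
Qed.

End LinearIndependence.

(** * Homogeneous decompositions *)

Section Decompositions.
Variables (K : closedFieldType) (n l : nat) (C : closedFieldType).
Variable iota : {rmorphism {fraction {mpoly K[l]}} -> C}.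
Variables (P : {mpoly K[n]}) (Q : 'I_l -> {mpoly K[n]}).
Let F := generic_sum iota P Q.

Lemma GL2_of_two_monomials (phi psi : {mpoly K[n]}) (u v : K * K) :
    u.1 * v.2 - u.2 * v.1 != 0 ->
    is_monomial (linear_value u phi psi) -> is_monomial (linear_value v phi psi) ->
  monomial_couple_upto_GL2 phi psi.
Proof.
set D := _ - _ => D0 mu mv.
pose M : 'M[K]_2 := \matrix_(i, j)
  (if i == 0 then if j == 0 then u.1 else u.2 else if j == 0 then v.1 else v.2).
pose L : 'M[K]_2 := \matrix_(i, j)
  (if i == 0 then if j == 0 then v.2 / D else - u.2 / D
   else if j == 0 then - v.1 / D else u.1 / D).
exists L, (linear_value u phi psi), (linear_value v phi psi); split=> //.
- have LM : L *m M = 1%:M.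
    apply/matrixP=> i j; rewrite !mxE !big_ord_recl big_ord0 addr0 !mxE /=.
    by case: i => [[|[|//]] hi]; case: j => [[|[|//]] hj];
       rewrite -?val_eqE /= ?mulr1n ?mulr0n; move: D0; rewrite /D => D0; field.
  by case/mulmx1_unit: LM.
- have e1 : v.2 / D * u.1 + - u.2 / D * v.1 = 1 by move: D0; rewrite /D => D0; field.
  have e2 : v.2 / D * u.2 + - u.2 / D * v.2 = 0 by move: D0; rewrite /D => D0; field.
  rewrite /linear_value !mxE /= !scalerDr !scalerA addrACA -!scalerDl e1 e2.
  by rewrite scale1r scale0r addr0.
- have e1 : - v.1 / D * u.1 + u.1 / D * v.1 = 0 by move: D0; rewrite /D => D0; field.
  have e2 : - v.1 / D * u.2 + u.1 / D * v.2 = 1 by move: D0; rewrite /D => D0; field.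
  rewrite /linear_value !mxE /= !scalerDr !scalerA addrACA -!scalerDl e1 e2.
  by rewrite scale1r scale0r add0r.
Qed.

(** The form [H] has coefficients in [C], but [generic_sum_span] replaces it by
    forms with coefficients in [K], one for each term of the generic sum. *)
Lemma decomposition_form phi psi (H : {mpoly C[2]}) d : H \is d.-homog ->
    F = H \mPo [tuple ext_poly iota phi; ext_poly iota psi] ->
  forall R, R \in P :: codom Q -> exists a : nat -> K, R = form_value d a phi psi.
Proof.
move=> hd eF R RPQ.
have [h eh] : exists h, F = form_value d h (ext_poly iota phi) (ext_poly iota psi).
  rewrite eF comp_mpolyE; apply: form_value_sum => m mH.
  have em : m ord_max = (d - m ord0)%N.
    have := dhomog_mf hd mH; rewrite /= mdegE !big_ord_recl big_ord0 addn0.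
    by move<-; rewrite addKn; congr (m _); apply: val_inj.
  have le : (m ord0 <= d)%N.
    have <- := dhomog_mf hd mH.
    by rewrite /= mdegE big_ord_recl leq_addr.
  rewrite !big_ord_recl big_ord0 mulr1.
  rewrite (_ : lift ord0 ord0 = ord_max); last exact: val_inj.
  by rewrite em (tnth_nth 0) (tnth_nth 0) /= form_value_mono //; eexists.
have eF' : F = \sum_(j < d.+1) h j *: ext_poly iota (phi ^+ j * psi ^+ (d - j)).
  by rewrite eh; apply: eq_bigr => j _; rewrite rmorphM !rmorphXn.
have [c ->] := generic_sum_span eF' RPQ.
exists (fun j => c (inord j)); apply: eq_bigr => j _.
by rewrite inord_val.
Qed.

(** All the linear factors of the forms expressing [P] and the [Q i] are
    monomials. If two of them are not proportional, they are the images of the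
    couple under a change of coordinates; if they are all proportional, then
    [P] and the [Q i] are proportional too. *)
Lemma decomposition_monomial_couple phi psi (H : {mpoly C[2]}) (i0 : 'I_l) :
    (1 < msize P)%N -> (forall R, R \in P :: codom Q -> is_monomial R) ->
    ~ eq_upto_const P (Q i0) ->
    homogeneous_decomposition iota F phi psi H ->
  monomial_couple_upto_GL2 phi psi.
Proof.
move=> Pnc mon nPQ [_ _ [d hd] eF].
have split R : R \in P :: codom Q -> exists c s,
    [/\ c != 0, size s = d, forall u, u \in s -> u != (0, 0),
        R = c *: \prod_(u <- s) linear_value u phi psi
      & forall u, u \in s -> is_monomial (linear_value u phi psi)].
  move=> RPQ; have [c0 [m [c00 eR]]] := mon R RPQ.
  have [a ea] := decomposition_form hd eF RPQ.
  have [|c [s [cn0 sd sn0 es]]] := @form_split K n d a.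
    have [//|no] := classic (exists2 j, (j <= d)%N & a j != 0).
    have /mpolyP/(_ m) : R = 0.
      rewrite ea /form_value big1 // => j _.
      have [->|aj] := eqVneq (a j) 0; first by rewrite scale0r.
      by case: no; exists j; rewrite // -ltnS.
    by rewrite eR mcoeffZ mcoeffX eqxx mulr1 mcoeff0 => z; rewrite z eqxx in c00.
  exists c, s; split; rewrite // ?ea // => u us.
  move: ea; rewrite es (big_rem u us) /= eR scalerAr => e.
  exact: (monomial_factor c00 (esym e)).
have [cP [sP [cP0 sPd sP0 eP mP]]] := split P (mem_head _ _).
have [|cQ [sQ [cQ0 sQd sQ0 eQ mQ]]] := split (Q i0).
  by rewrite inE codom_f orbT.
have [w ws] : exists w, w \in sP.
  case: sP eP {sPd sP0 mP} => [eP|w s _]; last by exists w; rewrite mem_head.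
  move: Pnc; rewrite eP big_nil -mul_mpolyC mulr1 ltnNge msizeC.
  by case: (cP != 0).
have w0 := sP0 w ws.
have [[v [vs vw]]|no] := classic (exists v, v \in sP ++ sQ /\ w.1 * v.2 - w.2 * v.1 != 0).
  apply: (GL2_of_two_monomials vw (mP w ws)).
  by move: vs; rewrite mem_cat => /orP[/mP|/mQ].
have prop v : v \in sP ++ sQ -> exists t,
    linear_value v phi psi = t *: linear_value w phi psi.
  move=> vs; have /eqP : w.1 * v.2 - w.2 * v.1 == 0.
    by apply/negPn/negP=> h; apply: no; exists v.
  move/eqP; rewrite subr_eq0 => /eqP e.
  have [w10|w10] := eqVneq w.1 0.
    have w20 : w.2 != 0.
      by apply: contraNneq w0 => z; rewrite [w]surjective_pairing w10 z.
    have v10 : v.1 = 0.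
      by apply/eqP; move/eqP: e; rewrite w10 mul0r eq_sym mulf_eq0 (negPf w20).
    exists (v.2 / w.2); rewrite /linear_value w10 v10 !scale0r !add0r scalerA.
    by rewrite divfK.
  exists (v.1 / w.1); rewrite /linear_value scalerDr !scalerA divfK //.
  by rewrite mulrAC [v.1 * _]mulrC -e mulrAC mulfV ?mul1r.
have pow s : {subset s <= sP ++ sQ} -> exists t,
    \prod_(u <- s) linear_value u phi psi = t *: linear_value w phi psi ^+ size s.
  elim: s => [|u s IH] hs; first by exists 1; rewrite big_nil scale1r.
  have [|t et] := IH; first by move=> x xs; apply: hs; rewrite inE xs orbT.
  have [t' et'] := prop u (hs u (mem_head _ _)).
  exists (t' * t); rewrite big_cons et et' -scalerAl -scalerAr scalerA exprS //.
have [|tP etP] := pow sP; first by move=> x xs; rewrite mem_cat xs.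
have [|tQ etQ] := pow sQ; first by move=> x xs; rewrite mem_cat xs orbT.
have [aP [kP [aP0 ePm]]] := mon P (mem_head _ _).
have [|aQ [kQ [aQ0 eQm]]] := mon (Q i0); first by rewrite inE codom_f orbT.
have nz (a : K) k : a != 0 -> a *: 'X_[k] != 0 :> {mpoly K[n]}.
  by move=> a0; rewrite -mul_mpolyC mulf_neq0 ?mpolyC_eq0 // -msize_poly_eq0 msizeX.
have tP0 : tP != 0.
  by apply: contraTneq (nz _ kP aP0) => z; rewrite -ePm eP etP z scale0r scaler0 eqxx.
have tQ0 : tQ != 0.
  by apply: contraTneq (nz _ kQ aQ0) => z; rewrite -eQm eQ etQ z scale0r scaler0 eqxx.
case: nPQ; exists (cP * tP / (cQ * tQ)); first by rewrite mulf_neq0 ?invr_eq0 ?mulf_neq0.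
by rewrite eP eQ etP etQ sPd sQd !scalerA divfK // mulf_neq0.
Qed.

End Decompositions.

(** * Reducible generic sums *)

Lemma frobenius_sum (R : comNzRingType) p (I : Type) (r : seq I) (F : I -> R) :
  p \in [pchar R] -> (\sum_(i <- r) F i) ^+ p = \sum_(i <- r) F i ^+ p.
Proof. by move=> chp; rewrite -(pFrobenius_autE chp) rmorph_sum. Qed.

Lemma closed_field_root (k : closedFieldType) (a : k) e : (0 < e)%N ->
  exists b, b ^+ e = a.
Proof.
move=> e0; have /closed_rootP[b] : size ('X^e - a%:P) != 1%N.
  by rewrite size_XnsubC // eqSS -lt0n.
by rewrite rootE !hornerE subr_eq0 => /eqP; exists b.
Qed.

Lemma pchar_mpoly (k : fieldType) n p : p \in [pchar k] -> p \in [pchar {mpoly k[n]}].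
Proof. exact: (rmorph_pchar (@mpolyC n k)). Qed.

Section PowersOfVariables.
Variables (k : fieldType) (n p : nat).
Hypothesis chp : p \in [pchar k].

Lemma msupp_frobenius (h : {mpoly k[n]}) m :
  m \in msupp (h ^+ p) -> exists m', m = (m' *+ p)%MM.
Proof.
rewrite {1}[h]mpolyE frobenius_sum; last exact: pchar_mpoly.
move/msupp_sum_le/flatten_mapP => [m' _].
rewrite exprZn => /msuppZ_le; rewrite mpolyXn msuppX inE => /eqP->.
by exists m'.
Qed.

End PowersOfVariables.

Lemma in_powers_monomial (K : fieldType) n a c (m : 'X_{1..n}) :
  in_powers a (c *: 'X_[K, m *+ a]).
Proof.
exists (c *: 'X_[m]); rewrite comp_mpolyZ comp_mpolyX; congr (_ *: _).
rewrite mpolyXE_id; apply: eq_bigr => i _.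
by rewrite tnth_map tnth_ord_tuple mulmnE mulnC exprM.
Qed.

Lemma bidegree_inj (x y d i j : nat) : (i <= d)%N -> (j <= d)%N -> i != j ->
  (x * i + y * (d - i) = x * j + y * (d - j))%N -> x = y.
Proof.
move=> id jd /eqP ij e.
have : (x%:Z - y%:Z) * (i%:Z - j%:Z) = 0.
  by move: e; rewrite -(subnK id) -(subnK jd) !addnK; nia.
by move/eqP; rewrite mulf_eq0 !subr_eq0 !eqz_nat => /orP[]/eqP.
Qed.

Section Reducibility.
Variables (K : closedFieldType) (n l : nat) (C : closedFieldType).
Variable iota : {rmorphism {fraction {mpoly K[l]}} -> C}.
Variables (P : {mpoly K[n]}) (Q : 'I_l -> {mpoly K[n]}).
Let F := generic_sum iota P Q.

Lemma ext_in_powers p (R : {mpoly K[n]}) : p \in [pchar K] -> in_powers p R ->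
  exists h, ext_poly iota R = h ^+ p.
Proof.
move=> chp [q ->]; have p0 : (0 < p)%N by rewrite prime_gt0 // (pcharf_prime chp).
have chC : p \in [pchar C] by apply: (rmorph_pchar (base_emb iota)).
have /fin_all_exists [r hr] : forall m : 'X_{1..n < msize q},
    exists b : C, b ^+ p = base_emb iota q@_m.
  by move=> m; apply: closed_field_root.
exists (\sum_m r m *: 'X_[(m : 'X_{1..n})]).
rewrite frobenius_sum; last exact: pchar_mpoly.
rewrite (comp_mpolywE _ (leqnn _)) rmorph_sum; apply: eq_bigr => m _ /=.
rewrite ext_polyZ exprZn hr; congr (_ *: _).
rewrite mpolyXn [in RHS]mpolyXE_id rmorph_prod; apply: eq_bigr => i _.
by rewrite tnth_map tnth_ord_tuple /= !rmorphXn /= ext_polyX -exprM mulmnE mulnC.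
Qed.

Lemma generic_sum_nonconst : (1 < msize P)%N -> (1 < msize F)%N.
Proof.
case/nonconst_supp=> m mP m0; apply: supp_nonconst m0.
by apply/msupp_generic_sum; exists P; rewrite ?inE ?eqxx.
Qed.

Lemma pth_power_reducible p : (1 < msize P)%N -> p \in [pchar K] ->
  (forall R, R \in P :: codom Q -> in_powers p R) -> reducible F.
Proof.
move=> Pnc chp hR; have p1 : (1 < p)%N by rewrite prime_gt1 // (pcharf_prime chp).
have chC : p \in [pchar C] by apply: (rmorph_pchar (base_emb iota)).
have [hP ehP] := ext_in_powers chp (hR P (mem_head _ _)).
have /fin_all_exists [hQ ehQ] : forall i, exists h, ext_poly iota (Q i) = h ^+ p.
  by move=> i; apply: ext_in_powers chp _; apply: hR; rewrite inE codom_f orbT.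
have /fin_all_exists [r hr] : forall i, exists b : C, b ^+ p = lam iota i.
  by move=> i; apply: closed_field_root; apply: ltnW.
pose h := hP + \sum_i r i *: hQ i.
have eF : F = h ^+ p.
  have chM := pchar_mpoly n chC.
  rewrite /h -(pFrobenius_autE chM) rmorphD rmorph_sum /F /generic_sum ehP.
  congr (_ + _); apply: eq_bigr => i _.
  by rewrite ehQ -hr -exprZn.
have Fnc := generic_sum_nonconst Pnc.
have h0 : h != 0.
  by apply: contraTneq Fnc => z; rewrite eF z expr0n -leqNgt gtn_eqF ?msize0 // ltnW.
have hnc : (1 < msize h)%N.
  rewrite ltnNge; apply: contraL Fnc => /msize1_polyC eh.
  by rewrite eF eh -rmorphXn /= -leqNgt msizeC leq_b1.
exists h, (h ^+ p.-1); split=> //; last by rewrite eF -exprS prednK // ltnW.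
have -> : p.-1 = p.-2.+1 by case: p p1 {chp hR chC ehP ehQ hr eF} => [|[]].
by rewrite exprS nonconstMl // -exprS expf_neq0.
Qed.

(** The generic sum is a binary form of degree [d] in two monomials. Its
    extreme coefficients are nonzero, so that both monomials occur in each of
    its [d] linear factors and none of these is constant. *)
Lemma two_monomials_reducible (m1 m2 : {mpoly K[n]}) d :
    (1 < msize P)%N -> is_monomial m1 -> is_monomial m2 ->
    relatively_prime [:: m1; m2] -> (1 < d)%N ->
    (forall R, R \in P :: codom Q -> exists2 k : nat, (k <= d)%N &
       eq_upto_const R (m1 ^+ k * m2 ^+ (d - k))) ->
    (exists2 R, R \in P :: codom Q & eq_upto_const R (m1 ^+ d)) ->
    (exists2 R, R \in P :: codom Q & eq_upto_const R (m2 ^+ d)) ->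
  reducible F.
Proof.
move=> Pnc [c1 [x1 [c10 em1]]] [c2 [x2 [c20 em2]]] cop d1 form [R1 R1PQ e1] [R2 R2PQ e2].
have x12 : x1 != x2.
  apply/eqP=> e; have [z|z] := eqVneq x1 0%MM; last first.
    apply: (cop 'X_[x1]); first by apply: (@supp_nonconst _ _ _ x1); rewrite ?msuppX ?inE.
    move=> q; rewrite !inE => /orP[]/eqP->; [exists c1%:MP | exists c2%:MP];
    by rewrite mul_mpolyC ?em1 ?em2 -?e.
  have [k _ [c c0 eP]] := form P (mem_head _ _).
  move: Pnc; rewrite eP em1 em2 -e z mpolyX0 !exprZn !expr1n -scalerAl mul1r !scalerA.
  by rewrite alg_mpolyC msizeC ltnNge leq_b1.
pose X1 : {mpoly C[n]} := 'X_[x1]; pose X2 : {mpoly C[n]} := 'X_[x2].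
have formR R : R \in P :: codom Q -> forall c, exists a, c *: ext_poly iota R = form_value d a X1 X2.
  move=> /form [k kd [c c0 ->]] b; rewrite em1 em2 !exprZn -scalerAl -scalerAr !scalerA.
  have ex : ext_poly iota ('X_[x1] ^+ k * 'X_[x2] ^+ (d - k)) = X1 ^+ k * X2 ^+ (d - k).
    by rewrite rmorphM !rmorphXn /= !ext_polyX.
  rewrite ext_polyZ ex scalerA form_value_mono //.
  by eexists.
have [a eF] : exists a, F = form_value d a X1 X2.
  have [aP eP] := formR P (mem_head _ _) 1.
  have [|aQ eQ] := @form_value_sum C n _ (index_enum 'I_l) (fun i => lam iota i *: ext_poly iota (Q i)) d X1 X2.
    by move=> i _; apply: formR; rewrite inE codom_f orbT.
  by rewrite /F /generic_sum eQ -[ext_poly iota P]scale1r eP form_value_add; eexists.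
have coefF j : (j <= d)%N -> F@_(x1 *+ j + x2 *+ (d - j)) = a j.
  move=> jd; rewrite eF raddf_sum (bigD1 (Ordinal (jd : j < d.+1)%N)) //=.
  rewrite mcoeffZ !mpolyXn -mpolyXD mcoeffX eqxx mulr1 big1 ?addr0 // => i ij.
  rewrite mcoeffZ !mpolyXn -mpolyXD mcoeffX; case: eqP; rewrite ?mulr0 // => e.
  case/eqP: x12; apply/mnmP=> t; move/mnmP/(_ t): e; rewrite !mnmDE !mulmnE.
  apply: (bidegree_inj (leq_ord i) jd).
  by apply: contraNneq ij => h; apply/eqP/val_inj.
have corner R x y z : R \in P :: codom Q -> y != 0 -> eq_upto_const R ((y *: 'X_[x]) ^+ d) ->
    z = (x *+ d)%MM -> F@_z != 0.
  move=> RPQ y0 [c c0 eR] ->; rewrite -mcoeff_msupp; apply/msupp_generic_sum.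
  exists R => //; rewrite eR exprZn scalerA mpolyXn msuppMCX ?inE //.
  by rewrite mulf_neq0 ?expf_neq0.
have ad : a d != 0.
  rewrite -(coefF d (leqnn d)); apply: (corner R1 x1 c1) => //; first by rewrite -em1.
  by rewrite subnn mulm0n addm0.
have a0 : a 0%N != 0.
  rewrite -(coefF 0%N (leq0n d)); apply: (corner R2 x2 c2) => //; first by rewrite -em2.
  by rewrite subn0 mulm0n add0m.
have [|c [s [c0 sd sn0 es]]] := @form_split C n d a; first by exists d.
have s12 u : u \in s -> u.1 != 0 /\ u.2 != 0.
  move=> us; split.
    apply: contraNneq ad => u1; have := es 1 0.
    rewrite (big_rem u us) /= [linear_value u _ _]/linear_value u1 scale0r scaler0 addr0 mul0r scaler0.
    rewrite /form_value big_ord_recr /= subnn expr0 expr1n mulr1 big1 ?add0r.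
      by rewrite alg_mpolyC => /eqP; rewrite mpolyC_eq0.
    by move=> j _; rewrite expr0n subn_eq0 leqNgt ltn_ord mulr0 scaler0.
  apply: contraNneq a0 => u2; have := es 0 1.
  rewrite (big_rem u us) /= [linear_value u _ _]/linear_value u2 scale0r scaler0 addr0 mul0r scaler0.
  rewrite /form_value big_ord_recl /= expr0 expr1n mulr1 big1 ?addr0.
    by rewrite alg_mpolyC => /eqP; rewrite mpolyC_eq0.
  by move=> j _; rewrite expr0n mul0r scaler0.
have lin u : u \in s -> (1 < msize (linear_value u X1 X2))%N.
  case/s12=> u1 u2; have [z|nz] := eqVneq x1 0%MM.
    apply: (@supp_nonconst _ _ _ x2); last by rewrite -z eq_sym.
    by rewrite mcoeff_msupp mcoeffD !mcoeffZ /X1 /X2 !mcoeffX eqxx (negPf x12) mulr0 add0r mulr1.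
  apply: (@supp_nonconst _ _ _ x1) nz.
  by rewrite mcoeff_msupp mcoeffD !mcoeffZ /X1 /X2 !mcoeffX eqxx [x2 == _]eq_sym (negPf x12) mulr0 addr0 mulr1.
have Fn0 : F != 0.
  by apply: contraTneq (generic_sum_nonconst Pnc) => ->; rewrite msize0.
move: eF; rewrite es; case: s sd sn0 es s12 lin => [|u [|u' s]] /= sd _ _ _ lin.
- by move: d1; rewrite -sd.
- by move: d1; rewrite -sd.
rewrite !big_cons scalerAl => eF; have := Fn0; rewrite eF mulf_eq0 negb_or => /andP[_ r0].
exists (c *: linear_value u X1 X2), (linear_value u' X1 X2 * \prod_(j <- s) linear_value j X1 X2).
split=> //; first by rewrite msizeZ // lin // mem_head.
by apply: nonconstMl => //; apply: lin; rewrite !inE eqxx orbT.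
Qed.

End Reducibility.

(** * Factors of a reducible generic sum *)

Section Irreducibility.
Variables (C : closedFieldType) (n : nat).
Implicit Types (f g F : {mpoly C[n]}).

Lemma dvdr_msize f g : g != 0 -> dvdr f g -> (msize f <= msize g)%N.
Proof.
move=> g0 [c ec]; have : (c != 0) && (f != 0) by rewrite -negb_or -mulf_eq0 -ec.
case/andP=> c0 f0; rewrite ec msizeM //.
have : (0 < msize c)%N by rewrite lt0n msize_poly_eq0.
by case: (msize c) => // a _; rewrite addSn /= leq_addl.
Qed.

Lemma prime_nonconst f : prime_elt f -> (1 < msize f)%N.
Proof. by case=> f0; rewrite unit_mpolyE // -ltnNge. Qed.

Lemma prime_factor F : (1 < msize F)%N -> exists2 f, prime_elt f & dvdr f F.
Proof.
move=> Fnc; have F0 : F != 0 by apply: contraTneq Fnc => ->; rewrite msize0.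
have [u [[|f s] [uU sP eF]]] := factorial_mpoly F0.
  rewrite big_nil mulr1 in eF.
  by move: uU; rewrite -eF unit_mpolyE // leqNgt Fnc.
exists f; first by apply: sP; rewrite inE eqxx.
by rewrite eF big_cons mulrCA; apply: dvdr_mulr; exists 1; rewrite mul1r.
Qed.

Lemma prime_multiplicity f F : prime_elt f -> F != 0 ->
  exists e g, F = f ^+ e * g /\ ~ dvdr f g.
Proof.
move=> pf; have f1 := prime_nonconst pf.
have [m] := ubnP (msize F); elim: m F => // m IH F hm F0.
have [[c ec]|no] := classic (dvdr f F); last by exists 0%N, F; rewrite expr0 mul1r.
have : (c != 0) && (f != 0) by rewrite -negb_or -mulf_eq0 -ec.
case/andP=> c0 f0; have [||e [g [eg ng]]] := IH c.
- rewrite ltnS in hm; apply: leq_trans hm; rewrite ec msizeM //.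
  by case: (msize f) f1 => [|[|a]] // _; rewrite !addnS /= ltnS leq_addr.
- by [].
by exists e.+1, g; rewrite ec eg exprS mulrC mulrA.
Qed.

(** Split off from [F] the largest power [f ^+ e] of one of its primes. If the
    cofactor is constant, [F] is a proper power. Otherwise [Phi], a multiple of
    [f ^+ e], is coprime to the cofactor in the form needed to differentiate:
    in [u * G + Phi * v = 0], [Phi] divides [u], which has no room for more. *)
Lemma reducible_cases F : reducible F ->
  (exists f e, [/\ (1 < msize f)%N, (1 < e)%N & F = f ^+ e]) \/
  (exists Phi G m0, [/\ F = Phi * G, (1 < msize Phi)%N, (1 < msize G)%N, Phi@_m0 = 1
    & forall u v, u * G + Phi * v = 0 -> {subset msupp u <= msupp Phi} ->
      exists c, u = c *: Phi]).
Proof.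
case=> q [r [qnc rnc eF]].
have q0 : q != 0 by apply: contraTneq qnc => ->; rewrite msize0.
have r0 : r != 0 by apply: contraTneq rnc => ->; rewrite msize0.
have F0 : F != 0 by rewrite eF mulf_neq0.
have Fnc : (1 < msize F)%N by rewrite eF nonconstMl // -eF.
have [f pf fF] := prime_factor Fnc.
have [e [g [eg ng]]] := prime_multiplicity pf F0.
have fnc := prime_nonconst pf; have [f0 fU fP] := pf.
have e0 : (0 < e)%N.
  by rewrite lt0n; apply/eqP => z; apply: ng; move: fF; rewrite eg z expr0 mul1r.
have g0 : g != 0 by apply: contraNneq F0 => z; rewrite eg z mulr0.
have fe0 : f ^+ e != 0 by rewrite expf_neq0.
have fenc : (1 < msize (f ^+ e))%N.
  by rewrite -(prednK e0) exprS nonconstMl // -exprS prednK.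
have [gc|gnc] := leqP (msize g) 1; [left|right].
  have [c c0 ec] : exists2 c, c != 0 & g = c%:MP.
    have := msize1_polyC gc; exists g@_0 => //.
    by apply: contra g0 => /eqP z; rewrite (msize1_polyC gc) z.
  have [b eb] := closed_field_root c e0.
  have b0 : b != 0.
    by apply: contraNneq c0 => z; rewrite -eb z expr0n gtn_eqF.
  exists (b *: f), e; split; first by rewrite msizeZ.
    rewrite ltn_neqAle e0 andbT eq_sym; apply/eqP=> e1.
    have main q' r' : r' != 0 -> (1 < msize r')%N -> F = q' * r' -> ~ dvdr f q'.
      move=> r'0 r'nc e' [d ed]; have : c%:MP = d * r'.
        apply: (mulfI f0); rewrite -ec; move: e'; rewrite eg e1 expr1 => ->.
        by rewrite ed mulrAC mulrC.
      move=> ecd; have : (msize r' <= msize c%:MP_[n])%N.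
        by apply: dvdr_msize; [rewrite -ec | exists d].
      by rewrite msizeC c0 leqNgt r'nc.
    case: (fP q r); first by rewrite -eF.
      exact: (main q r).
    by apply: (main r q) => //; rewrite mulrC.
  by rewrite exprZn eb eg ec mulrC mul_mpolyC.
pose a := (f ^+ e)@_(mlead (f ^+ e)).
have a0 : a != 0 by rewrite mleadc_eq0.
exists (a^-1 *: f ^+ e), (a *: g), (mlead (f ^+ e)); split.
- by rewrite -scalerAl -scalerAr scalerA mulVf // scale1r.
- by rewrite msizeZ // invr_eq0.
- by rewrite msizeZ.
- by rewrite mcoeffZ mulVf.
move=> u v euv su; have du : dvdr (f ^+ e) u.
  apply: (prime_exp_dvdl pf ng); exists (- (a^-1 * a^-1) *: v).
  have : u * (a *: g) = - (a^-1 *: f ^+ e * v) by apply/eqP; rewrite -addr_eq0 euv.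
  move/(congr1 (fun x => a^-1 *: x)); rewrite -scalerAr scalerA mulVf // scale1r => ->.
  by rewrite -scalerAl scalerN scalerA scaleNr mulNr -scalerAl [v * _]mulrC.
have [->|u0] := eqVneq u 0; first by exists 0; rewrite scale0r.
have [w ew] := du; have : w != 0 by apply: contraNneq u0 => z; rewrite ew z mul0r.
move=> w0; have hsz : (msize u <= msize (f ^+ e))%N.
  rewrite -(mlead_deg u0); apply: leq_trans (msize_mdeg_lt _) (leqnn _).
  have := su _ (mlead_supp u0).
  by rewrite (perm_mem (msuppZ _ _)) // invr_eq0.
have /msize1_polyC ew1 : (msize w <= 1)%N.
  move: hsz; rewrite ew msizeM //; case: (msize (f ^+ e)) fenc => [|x] // _.
  by rewrite addnS /= -[X in (_ <= X)%N]add1n leq_add2r.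
exists (w@_0 * a); rewrite scalerA mulfK // -mul_mpolyC -ew1 //.
Qed.

(** If [f] had a single exponent, it would be a nonconstant monomial, and some
    variable would divide [f * g]. *)
Lemma factor_two_exponents f g : (forall i, exists2 m : 'X_{1..n},
      m \in msupp (f * g) & m i = 0%N) -> (1 < msize f)%N ->
  exists b1 b2, [/\ b1 \in msupp f, b2 \in msupp f & b1 != b2].
Proof.
move=> cop /nonconst_supp[b bf b0].
have [j bj] : exists j, b j != 0%N.
  have [//|no] := classic (exists j, b j != 0%N).
  case/eqP: b0; apply/mnmP=> j; rewrite mnm0E; apply/eqP.
  by apply/negPn/negP=> h; apply: no; exists j.
have [m /msuppM_le /allpairsP[[b' c] /= [b'f _ ->]]] := cop j.
rewrite mnmDE => /eqP; rewrite addn_eq0 => /andP[/eqP z _].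
by exists b, b'; split=> //; apply: contraNneq bj => ->; rewrite z.
Qed.

End Irreducibility.

Section Necessity.
Variables (K : closedFieldType) (n l : nat) (C : closedFieldType).
Variable iota : {rmorphism {fraction {mpoly K[l]}} -> C}.
Hypothesis hC : is_algebraic_closure iota.
Variables (P : {mpoly K[n]}) (Q : 'I_l -> {mpoly K[n]}) (i0 : 'I_l).
Hypothesis mon : forall R, R \in P :: codom Q -> is_monomial R.
Hypothesis cop : relatively_prime (P :: codom Q).
Let F := generic_sum iota P Q.

Lemma generic_no_variable i : exists2 m : 'X_{1..n}, m \in msupp F & m i = 0%N.
Proof.
have [R RPQ [m mR mi]] := relatively_prime_no_variable i cop mon.
by exists m => //; apply/msupp_generic_sum; exists R.
Qed.

Lemma factor_not_dvd_monomial f g : F = f * g -> (1 < msize f)%N ->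
  ~ exists u, ext_poly iota (Q i0) = f * u.
Proof.
move=> eF fnc [u eu]; have [|c [m [c0 eQ]]] := @mon (Q i0).
  by rewrite inE codom_f orbT.
have [a [x [a0 ef]]] : is_monomial f.
  apply: (@monomial_factor _ _ f u (base_emb iota c) m); first by rewrite fmorph_eq0.
  by rewrite -eu eQ ext_polyZ ext_polyX.
have [i|b1 [b2 []]] := @factor_two_exponents C n f g _ fnc.
  by rewrite -eF; apply: generic_no_variable.
by rewrite ef msuppMCX // !inE => /eqP-> /eqP->; rewrite eqxx.
Qed.

(** A factorization of the generic sum is a proper power or a product of two
    coprime factors. A power whose exponent is a multiple of the characteristic
    puts all exponents in multiples of the characteristic. Any other power
    is excluded, as its derivative would make a variable divide the sum. Two
    coprime factors lead to [two_monomial_form]. *)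
Lemma reducible_shape : reducible F ->
  (exists2 p : nat, p \in [pchar K] & forall R, R \in P :: codom Q -> in_powers p R) \/
  (exists (m1 m2 : 'X_{1..n}) (d : nat), [/\ (1 < d)%N,
    forall i, m1 i = 0%N \/ m2 i = 0%N,
    forall s, s \in msupp F ->
      exists2 k, (k <= d)%N & s = (m1 *+ k + m2 *+ (d - k))%MM,
    (m1 *+ d)%MM \in msupp F & (m2 *+ d)%MM \in msupp F]).
Proof.
case/reducible_cases=> [[f [e [fnc e1 eF]]]|[Phi [G [m0 [eF Pnc Gnc Phi1 copr]]]]].
  left; have f0 : f != 0 by apply: contraTneq fnc => ->; rewrite msize0.
  have [ez|enz] := eqVneq (e%:R : C) 0; last first.
    case: e e1 eF enz => [//|[//|e]] _ eF enz.
    case: (@factor_not_dvd_monomial f (f ^+ e.+1)) => //.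
    have [u eu] := power_derivative hC i0 eF f0 enz.
    by exists (f ^+ e * u); rewrite eu exprS mulrA.
  have [|p chp] := natf0_pchar (ltnW e1) (_ : e%:R == 0 :> C); first exact/eqP.
  have /dvdnP[e' ee] : (p %| e)%N by rewrite (dvdn_pcharf chp) ez.
  exists p; first by rewrite -(fmorph_pchar (base_emb iota)).
  move=> R RPQ; have [c [m [c0 eR]]] := mon RPQ.
  have [|m' em] := @msupp_frobenius C n p chp (f ^+ e') m.
    rewrite -exprM -ee -eF; apply/msupp_generic_sum; exists R => //.
    by rewrite eR msuppMCX ?inE.
  by rewrite eR em; apply: in_powers_monomial.
right; have G0 : G != 0 by apply: contraTneq Gnc => ->; rewrite msize0.
have nv i : exists2 m : 'X_{1..n}, m \in msupp (Phi * G) & m i = 0%N.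
  by rewrite -eF; apply: generic_no_variable.
have [b1 [b2 [b1f b2f b12]]] := factor_two_exponents nv Pnc.
have [|c1 [c2 [c1g c2g c12]]] := @factor_two_exponents C n G Phi _ Gnc.
  by move=> i; rewrite mulrC.
rewrite eF; apply: (two_monomial_form b1f b2f b12 c1g c2g c12 nv) => s.
rewrite -eF => /msupp_generic_sum [R RPQ sR].
have [u [v [su sv e]]] := coprime_factorization_monomials hC eF G0 Phi1 copr RPQ.
have [c [m [c0 eR]]] := mon RPQ.
move: sR e; rewrite eR msuppMCX // inE => /eqP->; rewrite ext_polyZ ext_polyX => e.
have b0 : base_emb iota c != 0 by rewrite fmorph_eq0.
exists ((base_emb iota c)^-1 *: u), ((base_emb iota c)^-1 *: v); split.
- by move=> x /msuppZ_le /su.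
- by move=> x /msuppZ_le /sv.
- by rewrite -scalerAl -scalerAr -scalerDr -e scalerA mulVf // scale1r.
Qed.

End Necessity.

Theorem theorem3p3
  (K : closedFieldType) (n l : nat) (hn : (2 <= n)%N) (hl : (1 <= l)%N)
  (C : closedFieldType) (iota : {rmorphism {fraction {mpoly K[l]}} -> C})
  (hC : is_algebraic_closure iota)
  (P : {mpoly K[n]}) (Q : 'I_l -> {mpoly K[n]})
  (hP : is_monomial P) (hPnc : (1 < msize P)%N)
  (hQ : forall i, is_monomial (Q i))
  (hdeg : forall i, (msize (Q i) <= msize P)%N)
  (hPQ : forall i, ~ eq_upto_const P (Q i))
  (hQQ : forall i j, i != j -> ~ eq_upto_const (Q i) (Q j))
  (hcop : relatively_prime (P :: codom Q)) :
  reducible (generic_sum iota P Q)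
  <->
  ( (exists2 p : nat, p \in [pchar K] &
       forall R, R \in P :: codom Q -> in_powers p R)
    \/
    ((exists (m1 m2 : {mpoly K[n]}) (d : nat),
        [/\ is_monomial m1 /\ is_monomial m2,
            relatively_prime [:: m1; m2],
            (1 < d)%N,
            (forall R, R \in P :: codom Q ->
               exists2 k : nat, (k <= d)%N &
                 eq_upto_const R (m1 ^+ k * m2 ^+ (d - k)))
          & (exists2 R, R \in P :: codom Q & eq_upto_const R (m1 ^+ d)) /\
            (exists2 R, R \in P :: codom Q & eq_upto_const R (m2 ^+ d))])
     /\
     (forall (phi psi : {mpoly K[n]}) (H : {mpoly C[2]}),
        homogeneous_decomposition iota (generic_sum iota P Q) phi psi H ->
        monomial_couple_upto_GL2 phi psi)) ).
Proof.
have mon R : R \in P :: codom Q -> is_monomial R.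
  by rewrite inE => /predU1P[->|/codomP[i ->]].
have i0 : 'I_l := Ordinal hl.
split=> [red|[[p chp hR]|[[m1 [m2 [d [[mo1 mo2] cop d1 form [c1 c2]]]]] _]]].
- have [hp|[x1 [x2 [d [d1 dis form c1 c2]]]]] := reducible_shape hC i0 mon hcop red.
    by left.
  right; split; last first.
    move=> phi psi H; exact: decomposition_monomial_couple hPnc mon (hPQ i0).
  exists 'X_[x1], 'X_[x2], d.
  have mX (x : 'X_{1..n}) : is_monomial ('X_[x] : {mpoly K[n]}).
    by exists 1, x; rewrite oner_eq0 scale1r.
  (* a member of the family is determined by its exponent, up to a constant *)
  have term m : m \in msupp (generic_sum iota P Q) ->
      exists2 R, R \in P :: codom Q & eq_upto_const R 'X_[m].
    case/msupp_generic_sum=> R RPQ mR; exists R => //.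
    have [c [m' [c0 eR]]] := mon R RPQ; exists c => //.
    by move: mR; rewrite eR msuppMCX // inE => /eqP->.
  split=> //.
  + have := @disjoint_monomials_coprime K n x1 x2 1 1 (oner_neq0 _) (oner_neq0 _) dis.
    by rewrite !scale1r.
  + move=> R RPQ; have [c [m [c0 eR]]] := mon R RPQ.
    have [|k kd em] := form m.
      by apply/msupp_generic_sum; exists R; rewrite // eR msuppMCX ?inE.
    by exists k => //; exists c => //; rewrite eR em mpolyXD !mpolyXn.
  + by rewrite !mpolyXn; split; apply: term.
- exact: pth_power_reducible hPnc chp hR.
- exact: two_monomials_reducible hPnc mo1 mo2 cop d1 form c1 c2.
Qed.
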